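(* Let $M$ be a Riemannian manifold, let $F$ be a probability distribution on $M$, and let $q_k\in M$, $k=0,1,2,\dots$, be such that $q_k\to q_0$ as $k\to\infty$, $F(U(q_k))=1$ for all $k\ge 0$, and $\mathrm{tr}(G\Sigma(q_0))<\infty$. If $v_k\in M_{q_k}$ and $w_k\in M_{q_k}$ ($k\ge 0$) are tangent vectors with $v_k\to v_0$ and $w_k\to w_0$ in the tangent bundle $TM$, then $$\langle v_k,(G\Sigma(q_k))(w_k)\rangle\longrightarrow\langle v_0,(G\Sigma(q_0))(w_0)\rangle\quad\text{as }k\to\infty.$$
   Context: $M_q$ is the tangent space at $q$, $G$ is the metric tensor with inner product $\langle\cdot,\cdot\rangle$, $d$ is the geodesic distance, and $q_k\to q_0$ means $d(q_k,q_0)\to0$. For $q\in M$, $V(q)\subset M_q$ is the maximal (star-shaped) neighborhood of the origin on which $\exp_q$ is a diffeomorphism and along whose rays geodesics from $q$ are minimizing, and $U(q)=\exp_q(V(q))$ is the maximal normal neighborhood of $q$; it is understood that $p\in U(q)$ if and only if $q\in U(p)$ (automatic when $M$ is complete). For $p\in U(q)$ write $\overrightarrow{qp}=\exp_q^{-1}p\in M_q$, so $\|\overrightarrow{qp}\|=d(q,p)$. A distribution $F$ on $M$ is a probability measure on the Borel $\sigma$-algebra of $M$. Its covariance field is the contravariant 2-tensor field $\Sigma(q)=\int_{U(q)}(\overrightarrow{qp})(\overrightarrow{qp})'\,dF(p)$. In local coordinates $x$ at $q$, with $G_x,\Sigma_x$ the matrices of $G(q),\Sigma(q)$, $G\Sigma(q)$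 is the linear operator on $M_q$ given by $v_x\mapsto\Sigma_xG_xv_x$, so $\langle v,(G\Sigma(q))(w)\rangle=v_x'G_x\Sigma_xG_xw_x$ and $\mathrm{tr}(G\Sigma(q))=\int_{U(q)}\|\overrightarrow{qp}\|^2dF(p)$. *)

(* Defs.v *)
(* MathComp-Analysis. *)
From HB Require Import structures.
From mathcomp Require Import all_boot all_order all_algebra.
From mathcomp Require Import all_classical all_reals all_analysis.

Set Implicit Arguments.
Unset Strict Implicit.
Unset Printing Implicit Defensive.

Import Order.TTheory GRing.Theory Num.Theory.
Import numFieldNormedType.Exports.

Local Open Scope classical_set_scope.
Local Open Scope ring_scope.

Section smooth_maps.
Context {R : realType} {V W : normedModType R}.

Fixpoint Ck_on (k : nat) (A : set V) (f : V -> W) : Prop :=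
  match k with
  | 0%N => forall x, A x -> {for x, continuous f}
  | k'.+1 => (forall x, A x -> differentiable f x) /\
             (forall v : V, Ck_on k' A (fun x => 'D_v f x))
  end.

(* Only meant for open [A]. *)
Definition smooth_on (A : set V) (f : V -> W) : Prop :=
  forall k, Ck_on k A f.

End smooth_maps.

(* The values of [chart i] off [chart_dom i], and of [chart_inv i] off the
   image of the chart, are junk.  The atlas need not be maximal: every notion
   below is unchanged when compatible charts are added. *)
Record smooth_manifold (R : realType) (n : nat) := SmoothManifold {
  carrier :> ptopologicalType ;
  carrier_hausdorff : hausdorff_space carrier ;
  carrier_second_countable : @second_countable carrier ;
  chart_index : Type ;
  chart_dom : chart_index -> set carrier ;
  chart : chart_index -> carrier -> 'cV[R]_n ;
  chart_inv : chart_index -> 'cV[R]_n -> carrier ;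
  chart_at : carrier -> chart_index ;
  chart_at_dom : forall q, chart_dom (chart_at q) q ;
  chart_dom_open : forall i, open (chart_dom i) ;
  chart_codom_open : forall i, open (chart i @` chart_dom i) ;
  chartK : forall i, {in chart_dom i, cancel (chart i) (chart_inv i)} ;
  chart_continuous : forall i q, chart_dom i q -> {for q, continuous (chart i)} ;
  chart_inv_continuous : forall i x, (chart i @` chart_dom i) x ->
    {for x, continuous (chart_inv i)} ;
  chart_transition_smooth : forall i j,
    smooth_on (chart i @` (chart_dom i `&` chart_dom j))
              (chart j \o chart_inv i)
}.

Arguments chart_index {R n} _.
Arguments chart_dom {R n _} i _.
Arguments chart {R n _} i _.
Arguments chart_inv {R n _} i _.
Arguments chart_at {R n _} _.

Section tangent_vectors.
Context {R : realType} {n : nat} (M : smooth_manifold R n).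

(* A tangent vector at q is the family of its coordinate columns in all the
   charts around q, extended by 0 to the other charts.  The vector space
   operations of M_q are the pointwise ones of this function type. *)
Definition tvec : Type := chart_index M -> 'cV[R]_n.

Definition coord_change (q : M) (i j : chart_index M) (x : 'cV[R]_n) :
  'cV[R]_n := 'd (chart j \o chart_inv i) (chart i q) x.

Definition tangent (q : M) : set tvec :=
  [set v | (forall i j, chart_dom i q -> chart_dom j q ->
              v j = coord_change q i j (v i)) /\
           (forall i, ~ chart_dom i q -> v i = 0)].

Definition tvec_of (q : M) (i : chart_index M) (x : 'cV[R]_n) : tvec :=
  fun j => if `[< chart_dom j q >] then coord_change q i j x else 0.

(* The topology of TM: a set of pairs (q, v) with v in M_q is open iff its
   trace in every bundle chart (q, v) |-> (chart i q, v i) is open. *)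
Definition TM_open (O : set (M * tvec)) : Prop :=
  forall i, open [set z : 'cV[R]_n * 'cV[R]_n |
    (chart i @` chart_dom i) z.1 /\
    O (chart_inv i z.1, tvec_of (chart_inv i z.1) i z.2)].

Definition TM_cvg (q : nat -> M) (v : nat -> tvec) (q0 : M) (v0 : tvec) :
  Prop :=
  forall O, TM_open O -> O (q0, v0) -> \forall k \near \oo, O (q k, v k).

Definition velocity (c : R -> M) (t : R) : tvec :=
  fun i => if `[< chart_dom i (c t) >] then derive1 (chart i \o c) t else 0.

(* C^1 on [0, 1] means C^1 on some open interval containing [0, 1]. *)
Definition C1_arc (c : R -> M) : Prop :=
  exists2 e : R, 0 < e & forall t, - e < t < 1 + e ->
    {for t, continuous c} /\
    forall i, chart_dom i (c t) ->
      derivable (chart i \o c) t 1 /\ {for t, continuous (derive1 (chart i \o c))}.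

End tangent_vectors.

(* [metric i q] is the matrix of the metric tensor at q in the chart i. *)
Record riemannian_manifold (R : realType) (n : nat) := RiemannianManifold {
  manifold :> smooth_manifold R n ;
  metric : chart_index manifold -> manifold -> 'M[R]_n ;
  metric_smooth : forall i, smooth_on (chart i @` chart_dom i)
    (fun x : 'cV[R]_n => metric i (chart_inv i x)) ;
  metric_sym : forall i q, chart_dom i q -> (metric i q)^T = metric i q ;
  metric_posdef : forall i q, chart_dom i q -> forall x : 'cV[R]_n, x != 0 ->
    0 < (x^T *m metric i q *m x) 0 0 ;
  metric_tensorial : forall i j q, chart_dom i q -> chart_dom j q ->
    forall x y : 'cV[R]_n,
      x^T *m metric i q *m y =
      (coord_change q i j x)^T *m metric j q *m coord_change q i j y
}.

Arguments metric {R n _} i _.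

Section riemannian_geometry.
Context {R : realType} {n : nat} (M : riemannian_manifold R n).

(* The choice of the chart is immaterial by [metric_tensorial]. *)
Definition inner (q : M) (v w : tvec M) : R :=
  ((v (chart_at q))^T *m metric (chart_at q) q *m w (chart_at q)) 0 0.

Definition tnorm (q : M) (v : tvec M) : R := Num.sqrt (inner q v v).

Definition arc_length (c : R -> M) : \bar R :=
  (\int[lebesgue_measure]_(t in `[0%R, 1%R])
     (tnorm (c t) (velocity c t))%:E)%E.

(* [curve_length p q l]: some piecewise C^1 curve from p to q, i.e. a
   concatenation of C^1 arcs, has length l. *)
Inductive curve_length : M -> M -> \bar R -> Prop :=
| curve_arc (c : R -> M) : C1_arc c ->
    curve_length (c 0) (c 1) (arc_length c)
| curve_cat (p q r : M) (l m : \bar R) :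
    curve_length p q l -> curve_length q r m -> curve_length p r (l + m)%E.

(* +oo when p and q lie in different connected components. *)
Definition gdist (p q : M) : \bar R := ereal_inf [set l | curve_length p q l].

Definition christoffel (i : chart_index M) (x : 'cV[R]_n) (k a b : 'I_n) : R :=
  let g (r s : 'I_n) := fun y : 'cV[R]_n => metric i (chart_inv i y) r s in
  let partial (r : 'I_n) (f : 'cV[R]_n -> R) := 'D_(delta_mx r 0) f x in
  2^-1 * \sum_(l < n) invmx (metric i (chart_inv i x)) k l *
    (partial a (g l b) + partial b (g l a) - partial l (g a b)).

Definition geodesic_on (J : set R) (c : R -> M) : Prop :=
  forall t, J t -> {for t, continuous c} /\
    forall i, chart_dom i (c t) ->
      let x := chart i \o c in
      [/\ derivable x t 1, derivable (derive1 x) t 1 &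
          forall k : 'I_n, derive1 (derive1 x) t k 0 +
            \sum_(a < n) \sum_(b < n)
              christoffel i (x t) k a b * derive1 x t a 0 * derive1 x t b 0 = 0].

Definition exp_graph (q : M) (v : tvec M) (p : M) : Prop :=
  exists c : R -> M,
    [/\ exists2 e : R, 0 < e & geodesic_on [set t | - e < t < 1 + e] c,
        c 0 = q, velocity c 0 = v & c 1 = p].

Definition exp_dom (q : M) : set (tvec M) :=
  [set v | tangent q v /\ exists p, exp_graph q v p].

(* exp_q v is the time-1 value of the geodesic from q with initial velocity v;
   off [exp_dom q] it takes the junk value q. *)
Definition expmap (q : M) (v : tvec M) : M := xget q (exp_graph q v).

Definition logmap_on (V : set (tvec M)) (q p : M) : tvec M :=
  xget 0 [set v | V v /\ expmap q v = p].

Definition open_in_tangent (q : M) (V : set (tvec M)) : Prop :=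
  V `<=` tangent q /\
  forall i, chart_dom i q -> open [set x : 'cV[R]_n | V (tvec_of q i x)].

(* exp_q is a diffeomorphism from V onto its image; smoothness is read in the
   linear coordinates of M_q given by a chart i at q and in the charts j of M.
   Continuity has to be asked for separately, because [chart j] is junk off its
   domain. *)
Definition exp_diffeo_on (q : M) (V : set (tvec M)) : Prop :=
  [/\ V `<=` exp_dom q,
      {in V &, injective (expmap q)},
      open (expmap q @` V),
      (forall i, chart_dom i q ->
         let E := fun x : 'cV[R]_n => expmap q (tvec_of q i x) in
         (forall x, V (tvec_of q i x) -> {for x, continuous E}) /\
         forall j, smooth_on [set x | V (tvec_of q i x) /\ chart_dom j (E x)]
                             (chart j \o E)) &
      (forall i, chart_dom i q -> forall j,
         smooth_on (chart j @` (chart_dom j `&` expmap q @` V))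
           (fun y : 'cV[R]_n => logmap_on V q (chart_inv j y) i))].

Definition star_shaped (V : set (tvec M)) : Prop :=
  forall v (t : R), V v -> 0 <= t <= 1 -> V (t *: v).

Definition minimizing (c : R -> M) : Prop :=
  arc_length c = gdist (c 0) (c 1).

Definition normal_domain (q : M) (V : set (tvec M)) : Prop :=
  [/\ open_in_tangent q V, V 0, star_shaped V, exp_diffeo_on q V &
      forall v, V v -> minimizing (fun t : R => expmap q (t *: v))].

(* The largest normal domain at q. *)
Definition Vmax (q : M) : set (tvec M) :=
  xget set0 [set V | normal_domain q V /\
                     forall V', normal_domain q V' -> V' `<=` V].

Definition Umax (q : M) : set M := expmap q @` Vmax q.

Definition logmap (q p : M) : tvec M := logmap_on (Vmax q) q p.

End riemannian_geometry.

Notation borel M := (g_sigma_algebraType (@open (carrier (manifold M)))).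

Section covariance.
Context {R : realType} {n : nat} (M : riemannian_manifold R n).
Variable F : probability (borel M) R.

(* The matrix of the covariance tensor at q in the chart i.  An entry is the
   true integral only if the latter is finite, which holds for all entries as
   soon as [tr_GSigma q < +oo]. *)
Definition Sigma (i : chart_index M) (q : M) : 'M[R]_n :=
  \matrix_(a, b) \int[F]_(p in Umax q)
     (logmap q p i *m (logmap q p i)^T) a b.

Definition GSigma (q : M) (v : tvec M) : tvec M :=
  fun i => if `[< chart_dom i q >] then Sigma i q *m metric i q *m v i else 0.

(* The trace of GSigma(q) as an extended real, i.e. including the case in which
   the entries of Sigma(q) diverge. *)
Definition tr_GSigma (q : M) : \bar R :=
  (\int[F]_(p in Umax q) ((tnorm q (logmap q p)) ^+ 2)%:E)%E.

End covariance.

(* Main.v *)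
Require Import Defs.
From HB Require Import structures.
From mathcomp Require Import all_boot all_order all_algebra.
From mathcomp Require Import all_classical all_reals all_analysis.
From mathcomp Require Import measurable_realfun.
From mathcomp Require Import ring lra.
Import Order.TTheory GRing.Theory Num.Theory.
Import numFieldNormedType.Exports.
Local Open Scope classical_set_scope.
Local Open Scope ring_scope.

(** The number <v, G Sigma(q) w> is the integral over p of
    <v, log_q p> <w, log_q p> ([inner_GSigma]), so the theorem is an instance of
    dominated convergence ([cov_cvg]).  Two facts about q |-> log_q p are needed:
    a domination and a pointwise limit.

    Domination.  A geodesic has constant speed ([geodesic_speed]), hence
    |log_q p| = d(q, p) ([gdist_logmap]), and the triangle inequality gives
    |log_{q_k} p| <= 1 + |log_{q_0} p| as soon as d(q_k, q_0) < 1
    ([tnorm_logmap_le]).  The square of the right-hand side is integrable because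
    tr (G Sigma(q_0)) is finite and F is a probability.  By Cauchy-Schwarz it
    dominates the integrands, up to a constant that bounds |v_k| |w_k|.

    Pointwise limit ([logmap_cvg]).  Since p is in U(q) exactly when q is in U(p),
    log_q p can be expressed by exp_p and log_p alone: it is minus the velocity at
    time 1 of t |-> exp_p (t log_p q) ([logmap_reverse]).  Now log_p is continuous
    and exp_p is continuously differentiable, so this velocity depends
    continuously on q.

    The identity [logmap_reverse] says that the reversed geodesic c1 from q to p,
    which is minimizing, is the radial geodesic c2 from q to p.  As q is the
    centre of a normal domain, c2 is minimizing even a little beyond p.  If the
    velocities of c1 and c2 at p differed, then c1 followed by the continuation
    of c2 would be a minimizing curve with a corner at p, but a corner can be cut
    by a segment in a chart ([no_corner], [chord_length]).  So c1 and c2 have the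
    same velocity at p, and they agree by uniqueness of geodesics
    ([geodesic_unique]).  Uniqueness rests on a Gronwall estimate ([ode_zero]) and
    on the fact that Christoffel symbols are locally Lipschitz
    ([christoffel_loclip]). *)

Set Implicit Arguments.
Unset Strict Implicit.
Unset Printing Implicit Defensive.

(** * Curves and differentials in coordinates *)

Section calculus.
Context {R : realType}.

Lemma near_eq_derive1 (V : normedModType R) (f g : R -> V) t :
  {near t, f =1 g} -> derive1 f t = derive1 g t.
Proof. by move=> fg; rewrite !derive1E; apply: near_eq_derive. Qed.

Lemma derivable1_comp (V W : normedModType R) (f : V -> W) (c : R -> V) t :
  derivable c t 1 -> differentiable f (c t) -> derivable (f \o c) t 1.
Proof.
by move=> /derivable1_diffP dc df; apply/derivable1_diffP/differentiable_comp.
Qed.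

Lemma derive1_comp_diff (V W : normedModType R) (f : V -> W) (c : R -> V) t :
  derivable c t 1 -> differentiable f (c t) ->
  derive1 (f \o c) t = 'd f (c t) (derive1 c t).
Proof.
move=> /derivable1_diffP dc df.
rewrite derive1E'; last exact: differentiable_comp.
by rewrite diff_comp//= derive1E'.
Qed.

Lemma derivable1_continuous (V : normedModType R) (c : R -> V) t :
  derivable c t 1 -> {for t, continuous c}.
Proof. by move=> /derivable1_diffP/differentiable_continuous. Qed.

Lemma derivable1_coord m n (c : R -> 'M[R]_(m, n)) t i j :
  derivable c t 1 -> derivable (fun s => c s i j) t 1.
Proof. by move=> /derivable_mxP. Qed.

Lemma derive1_coord m n (c : R -> 'M[R]_(m, n)) t i j :
  derivable c t 1 -> derive1 (fun s => c s i j) t = derive1 c t i j.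
Proof. by move=> dc; rewrite !derive1E derive_mx// mxE. Qed.

Lemma is_derive1_coord m n (c : R -> 'M[R]_(m, n)) t i j :
  derivable c t 1 -> is_derive t 1 (fun s => c s i j) (derive1 c t i j).
Proof.
move=> dc; rewrite -derive1_coord// derive1E.
by apply/derivableP/derivable1_coord.
Qed.

Lemma derive1Z (V : normedModType R) a (f : R -> V) (t : R) :
  derivable f t 1 -> derive1 (fun s => a *: f s) t = a *: derive1 f t.
Proof. by move=> df; rewrite !derive1E; exact: deriveZ. Qed.

Lemma derive1_affine (V : normedModType R) (c : R -> V) (a b t : R) :
  derivable c (a * t + b) 1 ->
  derivable (fun s => c (a * s + b)) t 1 /\
  derive1 (fun s => c (a * s + b)) t = a *: derive1 c (a * t + b).
Proof.
move=> dc; pose h := fun s : R => a * s + b.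
have dh : is_derive t 1 h a.
  rewrite /h; apply: is_derive_eq.
  by rewrite /GRing.scale /=; ring.
have dcd : differentiable c (h t) by apply/derivable1_diffP.
split; first exact: (@derivable1_comp _ _ c h).
rewrite (@derive1_comp_diff _ _ c h)// [derive1 h t]derive1E.
rewrite derive_val deriv1E//.
Qed.

Lemma is_derive_scalel (V : normedModType R) (v : V) (t : R) :
  is_derive t 1 (fun s : R => s *: v) v.
Proof.
apply: DeriveDef; first exact/derivable1_diffP.
by rewrite deriveE// diff_val scale1r.
Qed.

Definition segm n (a b : 'cV[R]_n) (t : R) : 'cV[R]_n := a + t *: (b - a).

Lemma is_derive_segm n (a b : 'cV[R]_n) (t : R) :
  is_derive t 1 (segm a b) (b - a).
Proof.
have H := is_derive_scalel (b - a) t.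
rewrite /segm; apply: is_derive_eq; exact: add0r.
Qed.

Lemma derivable_segm n (a b : 'cV[R]_n) (t : R) : derivable (segm a b) t 1.
Proof. by have [] := is_derive_segm a b t. Qed.

Lemma derive1_segm n (a b : 'cV[R]_n) (t : R) : derive1 (segm a b) t = b - a.
Proof. by rewrite derive1E; have [] := is_derive_segm a b t. Qed.

Lemma continuous_segm n (a b : 'cV[R]_n) (t : R) :
  {for t, continuous (segm a b)}.
Proof. exact/derivable1_continuous/derivable_segm. Qed.

Lemma segm0 n (a b : 'cV[R]_n) : segm a b 0 = a.
Proof. by rewrite /segm scale0r addr0. Qed.

Lemma segm1 n (a b : 'cV[R]_n) : segm a b 1 = b.
Proof. by rewrite /segm scale1r addrC subrK. Qed.

Lemma sub_segm n (x a b : 'cV[R]_n) (t : R) :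
  x - segm a b t = (1 - t) *: (x - a) + t *: (x - b).
Proof. by rewrite /segm; apply/matrixP => k l; rewrite !mxE; ring. Qed.

(** The affine map that sends 0 to s and 1 to t keeps a neighbourhood of [0, 1]
    inside the interval: this turns a piece of a geodesic, or its reversal, into
    an arc that is defined on an open interval around [0, 1]. *)
Lemma affine_window (a b s t : R) : a < s < b -> a < t < b ->
  exists2 e : R, 0 < e &
    forall r, - e < r < 1 + e -> a < (t - s) * r + s < b.
Proof.
move=> sab tab.
pose m := Num.min (Num.min (b - s) (b - t)) (Num.min (s - a) (t - a)).
have m0 : 0 < m by rewrite !lt_min; lra.
have [m1 m2] : m <= b - s /\ m <= b - t by rewrite !ge_min !lexx !orbT.
have [m3 m4] : m <= s - a /\ m <= t - a by rewrite !ge_min !lexx !orbT.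
have ts0 : 0 < 1 + `|t - s| by rewrite ltr_wpDr.
pose d := m / 2 / (1 + `|t - s|).
have d0 : 0 < d by rewrite !divr_gt0.
have td : `|t - s| * d <= m / 2.
  by rewrite /d mulrCA ger_pMr ?divr_gt0// ler_pdivrMr// mul1r lerDr.
exists d => // r /andP[dr rd].
have [st|st] := leP 0 (t - s).
  rewrite ger0_norm// in td.
  have : (t - s) * (- d) <= (t - s) * r by rewrite ler_wpM2l// ltW.
  have : (t - s) * r <= (t - s) * (1 + d) by rewrite ler_wpM2l// ltW.
  by rewrite mulrN mulrDr mulr1; lra.
rewrite ltr0_norm// in td.
have : (t - s) * r <= (t - s) * (- d) by rewrite ler_wnM2l// ltW.
have : (t - s) * (1 + d) <= (t - s) * r by rewrite ler_wnM2l// ltW.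
by rewrite mulrN mulrDr mulr1 mulNr in td *; lra.
Qed.

Lemma col_sum_delta n (v : 'cV[R]_n) : v = \sum_a v a 0 *: delta_mx a 0.
Proof.
apply/colP => k; rewrite summxE (bigD1 k)//= big1 ?addr0.
  by rewrite !mxE !eqxx mulr1.
by move=> a ak; rewrite !mxE eq_sym (negbTE ak) mulr0.
Qed.

Lemma diff_col n (W : normedModType R) (f : 'cV[R]_n -> W) x v :
  differentiable f x ->
  'd f x v = \sum_a v a 0 *: 'D_(delta_mx a 0) f x.
Proof.
move=> df; rewrite {1}(col_sum_delta v) linear_sum; apply: eq_bigr => a _.
by rewrite linearZ deriveE.
Qed.

Section mx_cvg.
Context {T : Type} (F : set_system T) {FF : Filter F}.

Lemma cvg_mx m n (f : T -> 'M[R]_(m, n)) (l : 'M[R]_(m, n)) :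
  (forall i j, f t i j @[t --> F] --> l i j) -> f t @[t --> F] --> l.
Proof.
move=> fl; apply/cvgrPdist_le => /= e e0; near=> x.
rewrite /Num.Def.normr/= mx_normrE (bigmax_le _ (ltW e0))//= => i _.
rewrite !mxE/=; move: i; near: x; apply: filter_forall => /= i.
exact: ((cvgrPdist_le _ _).1 (fl i.1 i.2)).
Unshelve. all: by end_near. Qed.

Lemma cvg_sumr (V : normedModType R) (I : finType) (f : I -> T -> V) (l : I -> V) :
  (forall i, f i t @[t --> F] --> l i) ->
  \sum_i f i t @[t --> F] --> \sum_i l i.
Proof. by move=> fl; apply: cvg_big => [|i _]; [exact: add_continuous|]. Qed.

Lemma cvg_coord m n (f : T -> 'M[R]_(m, n)) (l : 'M[R]_(m, n)) i j :
  f t @[t --> F] --> l -> f t i j @[t --> F] --> l i j.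
Proof.
move=> fl.
apply: (@cvg_comp _ _ _ f (fun M : 'M[R]_(m, n) => M i j) _ _ _ fl).
exact: coord_continuous.
Qed.

Lemma cvg_mulmx m n p (f : T -> 'M[R]_(m, n)) (g : T -> 'M[R]_(n, p))
    (a : 'M[R]_(m, n)) (b : 'M[R]_(n, p)) :
  f t @[t --> F] --> a -> g t @[t --> F] --> b ->
  f t *m g t @[t --> F] --> a *m b.
Proof.
move=> fa gb; apply: cvg_mx => i j.
under eq_fun do rewrite mxE; rewrite mxE.
by apply: cvg_sumr => k; apply: cvgM; exact: cvg_coord.
Qed.

Lemma cvg_trmx m n (f : T -> 'M[R]_(m, n)) (a : 'M[R]_(m, n)) :
  f t @[t --> F] --> a -> (f t)^T @[t --> F] --> a^T.
Proof.
move=> fa; apply: cvg_mx => i j.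
by under eq_fun do rewrite mxE; rewrite mxE; exact: cvg_coord.
Qed.

(** The differential is a finite combination of the partial derivatives
    ([diff_col]), so their continuity makes it jointly continuous in the point
    and in the vector. *)
Lemma cvg_diff n (W : normedModType R) (f : 'cV[R]_n -> W) (x v : T -> 'cV[R]_n)
    x0 v0 :
  differentiable f x0 -> (\forall t \near F, differentiable f (x t)) ->
  (forall a, {for x0, continuous (fun x => 'D_(delta_mx a 0) f x)}) ->
  x t @[t --> F] --> x0 -> v t @[t --> F] --> v0 ->
  'd f (x t) (v t) @[t --> F] --> 'd f x0 v0.
Proof.
move=> df0 df cf xx0 vv0.
have H : \sum_a v t a 0 *: 'D_(delta_mx a 0) f (x t) @[t --> F] -->
    \sum_a v0 a 0 *: 'D_(delta_mx a 0) f x0.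
  apply: cvg_sumr => a; apply: cvgZ; first exact: cvg_coord.
  exact: (cvg_comp _ _ xx0 (cf a)).
rewrite -(diff_col v0 df0) in H; apply: cvg_trans H; apply: near_eq_cvg.
by apply: filterS df => t dft; exact/esym/diff_col.
Qed.

End mx_cvg.

End calculus.

(** * A Gronwall estimate *)

Section ode.
Context {R : realType}.

Lemma is_derive_sumr (V W : normedModType R) (I : finType) (h : I -> V -> W)
    (dh : I -> W) x v :
  (forall i, is_derive x v (h i) (dh i)) ->
  is_derive x v (\sum_i h i) (\sum_i dh i).
Proof.
by elim/big_ind2 : _ => // [|] *; [exact: is_derive_cst|exact: is_deriveD].
Qed.

Lemma derive0_const (f : R -> R) (a b s t : R) :
  (forall r : R, a < r < b -> is_derive r 1 f 0) ->
  a < s < b -> a < t < b -> f s = f t.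
Proof.
move=> df; wlog st : s t / s <= t.
  move=> H sab tab; have [st|/ltW ts] := leP s t; first exact: H.
  by apply/esym; exact: H.
move=> sab tab.
have [r _] : exists2 r, r \in `[s, t]%R & f t - f s = 0 * (t - s).
  apply: (@MVT_segment _ f (fun=> 0)) => //.
    by move=> x; rewrite in_itv/= => /andP[xt0 xt]; apply: df; lra.
  apply: derivable_within_continuous => x.
  rewrite in_itv/= => /andP[xt0 xt]; have xab : a < x < b by lra.
  by have [] := df x xab.
by rewrite mul0r => /eqP; rewrite subr_eq0 => /eqP.
Qed.

(** The function E t * exp (- C t) is nonincreasing. *)
Lemma gronwall_ge (E E' : R -> R) (C a b t0 : R) :
  a < t0 < b -> (forall t, a < t < b -> is_derive t 1 E (E' t)) ->
  (forall t, a < t < b -> E' t <= C * E t) -> E t0 = 0 ->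
  forall t, t0 <= t < b -> E t <= 0.
Proof.
move=> /andP[at0 t0b] dE EC E0 t /andP[t0t tb].
pose g s := E s * expR (- C * s).
have dg s : a < s < b -> is_derive s 1 g ((E' s - C * E s) * expR (- C * s)).
  move=> /dE dEs; rewrite /g; apply: is_derive_eq.
  by rewrite /GRing.scale /=; ring.
have [c ct] : exists2 c, c \in `[t0, t]%R &
    g t - g t0 = (E' c - C * E c) * expR (- C * c) * (t - t0).
  apply: (@MVT_segment _ g (fun s => (E' s - C * E s) * expR (- C * s))) => //.
    by move=> x; rewrite in_itv/= => /andP[xt0 xt]; apply: dg; lra.
  apply: derivable_within_continuous => x.
  rewrite in_itv/= => /andP[xt0 xt].
  have xab : a < x < b by lra.
  by have [] := dg x xab.
move: ct; rewrite in_itv/= => /andP[t0c ct].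
rewrite {2}/g E0 mul0r subr0 => gt.
have : g t <= 0.
  rewrite gt -mulrA mulr_le0_ge0//.
    by rewrite subr_le0 EC//; lra.
  by rewrite mulr_ge0 ?expR_ge0// subr_ge0.
by rewrite /g pmulr_lle0 ?expR_gt0.
Qed.

(** Going back in time is [gronwall_ge] for the reflected function. *)
Lemma gronwall_zero (E E' : R -> R) (C a b t0 : R) :
  a < t0 < b -> (forall t, a < t < b -> is_derive t 1 E (E' t)) ->
  (forall t, a < t < b -> 0 <= E t) ->
  (forall t, a < t < b -> `|E' t| <= C * E t) -> E t0 = 0 ->
  forall t, a < t < b -> E t = 0.
Proof.
move=> t0ab dE Ege0 EC E0 t tab; apply/eqP; rewrite eq_le Ege0// andbT.
have [t0t|tt0] := leP t0 t.
  apply: (@gronwall_ge E E' C _ _ _ t0ab dE _ E0); last by lra.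
  by move=> s /EC; rewrite ler_norml => /andP[].
rewrite -(opprK t).
apply: (@gronwall_ge (fun s => E (- s)) (fun s => - E' (- s)) C (- b) (- a) (- t0)); try lra.
- move=> s sab; have /dE dEs : a < - s < b by lra.
  have dN : is_derive s 1 (-%R : R -> R) (- 1) by apply: is_deriveNid.
  have := @is_derive1_comp _ E -%R s _ _ dEs dN.
  by rewrite mulrN1; apply.
- move=> s sab; have /EC : a < - s < b by lra.
  by rewrite ler_norml => /andP[+ _] /=; rewrite lerNl.
- by rewrite opprK.
Qed.

(** Expand the square and use 2 x y <= x^2 + y^2 for each of the products. *)
Lemma sqr_sum_le (K : finType) (z : K -> R) :
  (\sum_j `|z j|) ^+ 2 <= #|K|%:R * \sum_j z j ^+ 2.
Proof.
rewrite expr2 big_distrlr /=.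
apply: (@le_trans _ _ (\sum_i \sum_j (z i ^+ 2 + z j ^+ 2) / 2)).
  apply: ler_sum => i _; apply: ler_sum => j _.
  rewrite ler_pdivlMr// -subr_ge0 -(real_normK (num_real (z i))).
  rewrite -(real_normK (num_real (z j))).
  rewrite (_ : _ - _ = (`|z i| - `|z j|) ^+ 2) ?sqr_ge0//; ring.
set S := \sum_j z j ^+ 2.
have -> : \sum_i \sum_j (z i ^+ 2 + z j ^+ 2) / 2 =
    \sum_i (#|K|%:R * (z i ^+ 2 / 2) + S / 2).
  apply: eq_bigr => i _; rewrite -mulr_suml big_split/= sumr_const -/S.
  by rewrite mulrDl -[z i ^+ 2 *+ _]mulr_natl mulrA.
rewrite big_split/= sumr_const -mulr_sumr -mulr_suml -/S -[S / 2 *+ _]mulr_natl.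
by rewrite -mulrDr -splitr.
Qed.

(** The sum of the squares of the z j satisfies the hypotheses of
    [gronwall_zero].  Here z is meant to be the difference of two solutions of a
    differential equation with a Lipschitz right-hand side. *)
Lemma ode_zero (K : finType) (z z' : K -> R -> R) (C t0 : R) :
  (\forall t \near t0, forall j, is_derive (t : R) 1 (z j) (z' j t)) ->
  (\forall t \near t0, forall j, `|z' j t| <= C * \sum_k `|z k t|) ->
  (forall j, z j t0 = 0) ->
  \forall t \near t0, forall j, z j t = 0.
Proof.
move=> dz bz z0.
have /(nbhs_ballP (t0 : R)) [e /= e0 be] : nbhs (t0 : R) [set t |
    (forall j, is_derive (t : R) 1 (z j) (z' j t)) /\
    (forall j, `|z' j t| <= C * \sum_k `|z k t|)] by exact: filterI.
have {dz bz}be t : t0 - e < t < t0 + e ->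
    (forall j, is_derive t 1 (z j) (z' j t)) /\
    (forall j, `|z' j t| <= C * \sum_k `|z k t|).
  by move=> te; apply: be; rewrite /ball/= ltr_distlC; lra.
pose E t := \sum_j z j t ^+ 2.
have Ege0 t : 0 <= E t by apply: sumr_ge0 => j _; exact: sqr_ge0.
have C0 : 0 <= `|C| by [].
have E0 t : t0 - e < t < t0 + e -> E t = 0.
  apply: (@gronwall_zero E (fun t => \sum_j 2 * z j t * z' j t)
     (2 * `|C| * #|K|%:R) (t0 - e) (t0 + e) t0) => //; first by lra.
  - move=> s /be[dz _].
    rewrite /E (_ : (fun t => _) = \sum_j (fun t => z j t ^+ 2)); last first.
      by apply/funext => x; rewrite fct_sumE.
    apply: is_derive_sumr => j; have := dz j => {}dz.
    apply: is_derive_eq; rewrite /GRing.scale /=; ring.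
  - move=> s /be[_ bz]; apply: (le_trans (ler_norm_sum _ _ _)).
    apply: (@le_trans _ _ (2 * `|C| * (\sum_k `|z k s|) ^+ 2)); last first.
      by rewrite -[leRHS]mulrA ler_wpM2l ?mulr_ge0// sqr_sum_le.
    rewrite expr2 mulrA mulr_sumr; apply: ler_sum => j _.
    rewrite !normrM ger0_norm// -!mulrA ler_pM2l// mulrA mulrC.
    rewrite ler_wpM2r// (le_trans (bz j))// ler_wpM2r ?ler_norm//.
    exact: sumr_ge0.
  - by rewrite /E big1// => j _; rewrite z0 expr0n.
near=> t => j; apply/eqP; rewrite -sqrf_eq0; apply/eqP.
have : E t = 0.
  by apply: E0; near: t; apply: near_in_itvoo; rewrite in_itv/=; lra.
rewrite /E => /psumr_eq0P -> // i _; exact: sqr_ge0.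
Unshelve. all: by end_near. Qed.
End ode.

(** * Locally Lipschitz functions *)

Section loclip.
Context {R : realType} {X : normedModType R}.
Implicit Types (f g : X -> R) (x : X).

(** A bound over pairs of points near x, as opposed to pairs (x, y) only: it is
    the difference of two solutions that has to be estimated.  This property
    suffices for the uniqueness of geodesics, and it passes to inverse matrices
    without having to differentiate them. *)
Definition loclip f x := exists2 K : R, 0 <= K &
  \forall p \near (x, x), `|f p.1 - f p.2| <= K * `|p.1 - p.2|.

Lemma near_fst (P : X -> Prop) x :
  (\forall y \near x, P y) -> \forall p \near (x, x), P p.1.
Proof. by move=> Px; exact: (@cvg_fst _ _ (nbhs x) (nbhs x)). Qed.

Lemma near_snd (P : X -> Prop) x :
  (\forall y \near x, P y) -> \forall p \near (x, x), P p.2.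
Proof. by move=> Px; exact: (@cvg_snd _ _ (nbhs x) (nbhs x)). Qed.

Lemma loclip_near_eq f g x : (\forall y \near x, f y = g y) ->
  loclip f x -> loclip g x.
Proof.
move=> fg [K K0 fK]; exists K => //; near=> p.
have <- : f p.1 = g p.1 by near: p; exact: (near_fst fg).
have <- : f p.2 = g p.2 by near: p; exact: (near_snd fg).
by near: p.
Unshelve. all: by end_near. Qed.

Lemma loclip_continuous f x : loclip f x -> {for x, continuous f}.
Proof.
move=> [K K0 fK]; apply/cvgrPdist_le => e e0.
have fKx : \forall y \near x, `|f x - f y| <= K * `|x - y|.
  have [[A B] [/= nA nB] AB] := fK.
  near=> y; apply: (AB (x, y)); split => /=; first exact: nbhs_singleton.
  by near: y.
near=> y; apply: (le_trans (near fKx y _)) => //.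
apply: (@le_trans _ _ ((K + 1) * (e / (K + 1)))); last first.
  by rewrite mulrC divfK// gt_eqF// ltr_wpDl.
apply: ler_pM => //; first by rewrite lerDl.
near: y; apply: cvgr_dist_le; first exact: cvg_id.
by rewrite divr_gt0// ltr_wpDl.
Unshelve. all: by end_near. Qed.

Lemma loclip_bounded f x : loclip f x ->
  \forall y \near x, `|f y| <= `|f x| + 1.
Proof.
move=> /loclip_continuous/cvgrPdist_le/(_ 1 ltr01) H; near=> y.
have H1 : `|f x - f y| <= 1 by near: y.
rewrite -(subrK (f x) (f y)) addrC (le_trans (ler_normD _ _))// lerD2l.
by rewrite distrC.
Unshelve. all: by end_near. Qed.

Lemma loclip_cst (c : R) x : loclip (fun=> c) x.
Proof. by exists 0 => //; near=> p; rewrite subrr normr0 mul0r.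
Unshelve. all: by end_near. Qed.

Lemma loclipD f g x : loclip f x -> loclip g x -> loclip (fun y => f y + g y) x.
Proof.
move=> [K K0 fK] [L L0 gL]; exists (K + L); first exact: addr_ge0.
near=> p; rewrite opprD addrACA mulrDl (le_trans (ler_normD _ _))//.
by apply: lerD; near: p.
Unshelve. all: by end_near. Qed.

Lemma loclipM f g x : loclip f x -> loclip g x -> loclip (fun y => f y * g y) x.
Proof.
move=> lf lg; have bf := loclip_bounded lf; have bg := loclip_bounded lg.
move: lf lg => [K K0 fK] [L L0 gL].
exists ((`|f x| + 1) * L + (`|g x| + 1) * K).
  by rewrite addr_ge0// mulr_ge0// addr_ge0.
near=> p.
rewrite (_ : _ - _ = f p.1 * (g p.1 - g p.2) + g p.2 * (f p.1 - f p.2)); last ring.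
rewrite (le_trans (ler_normD _ _))// mulrDl !normrM -!mulrA.
apply: lerD; apply: ler_pM => //.
- by near: p; exact: (near_fst bf).
- by near: p.
- by near: p; exact: (near_snd bg).
- by near: p.
Unshelve. all: by end_near. Qed.

Lemma loclipN f x : loclip f x -> loclip (fun y => - f y) x.
Proof.
move=> lf; apply: (@loclip_near_eq (fun y => (- 1) * f y)).
  by near=> y; rewrite mulN1r.
by apply: loclipM => //; exact: loclip_cst.
Unshelve. all: by end_near. Qed.

Lemma loclipV f x : f x != 0 -> loclip f x -> loclip (fun y => (f y)^-1) x.
Proof.
move=> fx0 lf; have /cvgrPdist_le/(_ (`|f x| / 2)) := loclip_continuous lf.
rewrite divr_gt0// ?normr_gt0// => /(_ isT) fx2.
have {}fx2 : \forall y \near x, `|f x| / 2 <= `|f y|.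
  near=> y; have : `|f x - f y| <= `|f x| / 2 by near: y.
  have := ler_normD (f x - f y) (f y); rewrite subrK; lra.
have fxgt0 : 0 < `|f x| by rewrite normr_gt0.
move: lf => [K K0 fK]; exists ((`|f x| / 2)^-1 * (`|f x| / 2)^-1 * K).
  by rewrite !mulr_ge0// invr_ge0 divr_ge0.
near=> p.
have fp1 : `|f x| / 2 <= `|f p.1| by near: p; exact: (near_fst fx2).
have fp2 : `|f x| / 2 <= `|f p.2| by near: p; exact: (near_snd fx2).
have fx20 : 0 < `|f x| / 2 by rewrite divr_gt0.
have f10 : f p.1 != 0 by rewrite -normr_gt0 (lt_le_trans fx20).
have f20 : f p.2 != 0 by rewrite -normr_gt0 (lt_le_trans fx20).
rewrite (_ : _ - _ = (f p.1)^-1 * (f p.2)^-1 * (f p.2 - f p.1)); last first.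
  by field; rewrite f10 f20.
rewrite !normrM !normfV distrC -[leRHS]mulrA.
apply: ler_pM => //; last by near: p.
by apply: ler_pM => //; rewrite lef_pV2// ?posrE ?normr_gt0.
Unshelve. all: by end_near. Qed.

Lemma loclip_sum (I : finType) (P : pred I) (f : I -> X -> R) x :
  (forall i, loclip (f i) x) -> loclip (fun y => \sum_(i | P i) f i y) x.
Proof.
move=> lf; rewrite (_ : (fun _ => _) = \sum_(i | P i) f i); last first.
  by apply/funext => y; rewrite fct_sumE.
elim/big_ind : _ => //; first exact: loclip_cst.
by move=> g h; exact: loclipD.
Qed.

Lemma loclip_prod (I : finType) (f : I -> X -> R) x :
  (forall i, loclip (f i) x) -> loclip (fun y => \prod_i f i y) x.
Proof.
move=> lf; elim: (index_enum I) => [|i s IH].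
  by under eq_fun do rewrite big_nil; exact: loclip_cst.
by under eq_fun do rewrite big_cons; exact: loclipM.
Qed.

Lemma loclip_det n (A : X -> 'M[R]_n) x :
  (forall i j, loclip (fun y => A y i j) x) -> loclip (fun y => \det (A y)) x.
Proof.
move=> lA; apply: loclip_sum => s; apply: loclipM; first exact: loclip_cst.
by apply: loclip_prod => i.
Qed.

(** Cramer's rule: the entries are quotients of determinants. *)
Lemma loclip_invmx n (A : X -> 'M[R]_n) x i j : A x \in unitmx ->
  (forall i j, loclip (fun y => A y i j) x) ->
  loclip (fun y => invmx (A y) i j) x.
Proof.
rewrite unitmxE unitfE => Ax0 lA; have ld := loclip_det lA.
have lC : loclip (fun y => (\det (A y))^-1 * \adj (A y) i j) x.
  apply: loclipM; first exact: loclipV.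
  under eq_fun do rewrite mxE /cofactor.
  apply: loclipM; first exact: loclip_cst.
  apply: loclip_det => k l.
  by under eq_fun do rewrite !mxE.
apply: loclip_near_eq lC.
have ne0 : \forall y \near x, \det (A y) != 0.
  have : nbhs (\det (A x)) [set r | r != 0].
    by apply: open_nbhs_nbhs; split => //; exact: open_neq.
  exact: (loclip_continuous ld).
by apply: filterS ne0 => y ne0; rewrite /invmx unitmxE unitfE ne0 [RHS]mxE.
Qed.

End loclip.

Section loclip_maps.
Context {R : realType}.

Lemma loclip_comp (X Y : normedModType R) (h : X -> Y) (f : Y -> R) x :
  (forall y z, `|h y - h z| <= `|y - z|) -> loclip f (h x) -> loclip (f \o h) x.
Proof.
move=> hh [K K0 fK]; exists K => //.
have ch : {for x, continuous h}.
  apply/cvgrPdist_le => e e0; near=> y; apply: (le_trans (hh _ _)).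
  by near: y; apply: cvgr_dist_le => //; exact: cvg_id.
have [[A B] [/= nA nB] AB] := fK.
near=> p; apply: (le_trans (AB (h p.1, h p.2) _)); last first.
  by rewrite /= ler_wpM2l// hh.
by split => /=; near: p; [exact: (near_fst (ch _ nA))|exact: (near_snd (ch _ nB))].
Unshelve. all: by end_near. Qed.

Lemma mx_coord_le m n (A : 'M[R]_(m, n)) i j : `|A i j| <= `|A|.
Proof. by rewrite [leRHS]/Num.Def.normr/= mx_normrE (le_bigmax _ _ (i, j)). Qed.

Lemma mx_norm_le_sum n (v : 'cV[R]_n) : `|v| <= \sum_a `|v a 0|.
Proof.
rewrite [leLHS]/Num.Def.normr/= mx_normrE; apply: bigmax_le => [|[i j] _ /=].
  exact: sumr_ge0.
by rewrite (ord1 j) (bigD1 i)//= lerDl sumr_ge0.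
Qed.

Lemma mx_dist_le_sum n (u v : 'cV[R]_n) : `|u - v| <= \sum_a `|u a 0 - v a 0|.
Proof.
apply: (le_trans (mx_norm_le_sum _)); apply: ler_sum => a _.
by rewrite !mxE.
Qed.

Lemma loclip_coord n (x : 'cV[R]_n) a : loclip (fun v : 'cV[R]_n => v a 0) x.
Proof.
exists 1 => //; near=> p; rewrite mul1r.
by have := mx_coord_le (p.1 - p.2) a 0; rewrite !mxE.
Unshelve. all: by end_near. Qed.

(** The mean value theorem along segments of a ball on which the partial
    derivatives are bounded. *)
Lemma C1_loclip n (f : 'cV[R]_n -> R) x :
  (\forall y \near x, differentiable f y) ->
  (forall a, {for x, continuous (fun y => 'D_(delta_mx a 0) f y)}) ->
  loclip f x.
Proof.
move=> df cD.
pose B a := `|'D_(delta_mx a 0) f x| + 1.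
have bD : \forall y \near x, forall a, `|'D_(delta_mx a 0) f y| <= B a.
  suff : forall a, \forall y \near x, `|'D_(delta_mx a 0) f y| <= B a.
    by move=> H; exact: (filter_forall _ H).
  move=> a.
  have /cvgrPdist_le/(_ 1 ltr01) := cD a; apply: filterS => y H1.
  rewrite -(subrK ('D_(delta_mx a 0) f x) ('D_(delta_mx a 0) f y)) addrC.
  by rewrite (le_trans (ler_normD _ _))// lerD2l distrC.
exists (\sum_a B a); first by rewrite sumr_ge0// => a _; rewrite addr_ge0.
have [e /= e0 be] := (nbhs_ballP x _).1 (filterI df bD).
near=> p.
have p1 : ball x e p.1 by near: p; apply: (near_fst (P := ball x e)); exact: nbhsx_ballx.
have p2 : ball x e p.2 by near: p; apply: (near_snd (P := ball x e)); exact: nbhsx_ballx.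
pose l := segm p.2 p.1.
have bl (t : R) : 0 <= t <= 1 -> ball x e (l t).
  move=> t01; move: p1 p2; rewrite -!ball_normE/= => p1 p2.
  rewrite sub_segm (le_lt_trans (ler_normD _ _))// !normrZ !ger0_norm; [|lra|lra].
  have : (1 - t) * `|x - p.2| + t * `|x - p.1| <=
    Num.max `|x - p.2| `|x - p.1|.
    rewrite [leRHS](_ : _ = (1 - t) * Num.max `|x - p.2| `|x - p.1| +
      t * Num.max `|x - p.2| `|x - p.1|); last ring.
    by apply: lerD; apply: ler_wpM2l; rewrite ?le_max ?lexx ?orbT//; lra.
  by move=> /le_lt_trans; apply; rewrite gt_max p2.
have dfl (t : R) : 0 <= t <= 1 -> is_derive t 1 (f \o l) ('d f (l t) (p.1 - p.2)).
  move=> /bl /be [dft _]; have dlt := @derivable_segm _ _ p.2 p.1 t.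
  have := derive1_comp_diff dlt dft; rewrite derive1_segm derive1E => <-.
  by apply/derivableP/derivable1_comp.
have [c c01] : exists2 c, c \in `[0, 1]%R & (f \o l) 1 - (f \o l) 0 =
    'd f (l c) (p.1 - p.2) * (1 - 0).
  apply: (@MVT_segment _ (f \o l) (fun t => 'd f (l t) (p.1 - p.2))) => //.
    by move=> t; rewrite in_itv/= => /andP[t0 t1]; apply: dfl; lra.
  apply: derivable_within_continuous => t.
  by rewrite in_itv/= => t01; have [] := dfl t t01.
move: c01; rewrite in_itv/= => /bl /be [dfc bc].
rewrite /= /l segm1 segm0 subr0 mulr1 => ->.
rewrite diff_col// (le_trans (ler_norm_sum _ _ _))// mulr_suml.
apply: ler_sum => a _; rewrite normrM mulrC; apply: ler_pM => //.
exact: mx_coord_le.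
Unshelve. all: by end_near. Qed.

End loclip_maps.

(** * Smooth maps in coordinates *)

Section smooth.
Context {R : realType}.

Section normed_spaces.
Context {V W : normedModType R}.
Implicit Types (A : set V) (f : V -> W).

Lemma smooth_on_differentiable A f x : smooth_on A f -> A x -> differentiable f x.
Proof. by move=> sf Ax; have [df _] := sf 1%N; exact: df. Qed.

Lemma smooth_on_continuous A f x : smooth_on A f -> A x -> {for x, continuous f}.
Proof. by move=> sf; exact: (sf 0%N). Qed.

Lemma smooth_onD A f v : smooth_on A f -> smooth_on A (fun x => 'D_v f x).
Proof. by move=> sf k; have [_] := sf k.+1; exact. Qed.

End normed_spaces.

Lemma smooth_cvg_diff n (W : normedModType R) T (F : set_system T) {FF : Filter F}
    (A : set 'cV[R]_n) (f : 'cV[R]_n -> W) (x v : T -> 'cV[R]_n) x0 v0 :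
  open A -> smooth_on A f -> A x0 ->
  x t @[t --> F] --> x0 -> v t @[t --> F] --> v0 ->
  'd f (x t) (v t) @[t --> F] --> 'd f x0 v0.
Proof.
move=> oA sf Ax0 xx0 vv0; apply: cvg_diff => //.
- exact: smooth_on_differentiable Ax0.
- have : \forall t \near F, A (x t).
    by apply: xx0; exact: open_nbhs_nbhs.
  by apply: filterS => t; exact: smooth_on_differentiable.
- by move=> a; apply: smooth_on_continuous (smooth_onD _ sf) Ax0.
Qed.

Lemma smooth_derive_coord n p m (A : set 'cV[R]_n) (f : 'cV[R]_n -> 'M[R]_(p, m))
    x v i j : smooth_on A f -> A x ->
  'D_v (fun y => f y i j) x = 'D_v f x i j.
Proof.
move=> sf Ax; rewrite derive_mx ?mxE//.
exact/diff_derivable/(smooth_on_differentiable sf).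
Qed.

Lemma smooth_differentiable_coord n p m (A : set 'cV[R]_n)
    (f : 'cV[R]_n -> 'M[R]_(p, m)) x i j : smooth_on A f -> A x ->
  differentiable (fun y => f y i j) x.
Proof.
move=> sf Ax; apply: (@differentiable_comp _ _ _ _ f (fun B => B i j)).
  exact: (smooth_on_differentiable sf).
exact: differentiable_coord.
Qed.

Lemma smooth_loclip n p m (A : set 'cV[R]_n) (f : 'cV[R]_n -> 'M[R]_(p, m))
    x i j : open A -> smooth_on A f -> A x -> loclip (fun y => f y i j) x.
Proof.
move=> oA sf Ax.
have nA : nbhs x A by exact: open_nbhs_nbhs.
apply: C1_loclip.
  by apply: filterS nA => y; exact: smooth_differentiable_coord.
move=> a; have := smooth_on_continuous (smooth_onD (delta_mx a 0) sf) Ax.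
move=> /(cvg_coord (i := i) (j := j)) H.
rewrite /prop_for/continuous_at (smooth_derive_coord _ _ _ sf)//.
have fE : \forall y \near x, 'D_(delta_mx a 0) f y i j =
    'D_(delta_mx a 0) (fun z => f z i j) y.
  by apply: filterS nA => y Ay; rewrite (smooth_derive_coord _ _ _ sf).
exact: cvg_trans (near_eq_cvg fE) H.
Qed.

End smooth.

Lemma nbhs_open (T : topologicalType) (A : set T) :
  (forall x, A x -> nbhs x A) -> open A.
Proof. by rewrite openE. Qed.

Lemma open_nbhs1 (T : topologicalType) (A : set T) x : open A -> A x -> nbhs x A.
Proof. by move=> oA Ax; exact: open_nbhs_nbhs. Qed.

Lemma derive_comp (R : realType) (U V W : normedModType R) (f : U -> V)
    (g : V -> W) a (x : U) :
  differentiable f x -> differentiable g (f x) ->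
  'D_a (g \o f) x = 'd g (f x) ('d f x a).
Proof.
move=> df dg; rewrite deriveE; last exact: differentiable_comp.
by rewrite (diff_comp df dg).
Qed.

(** * Charts, tangent vectors and the topology of the tangent bundle *)

Section manifold.
Context {R : realType} {n : nat} (M : smooth_manifold R n).
Implicit Types (p q : M) (i j k : chart_index M) (v w : tvec M).

Lemma chartKq i q : chart_dom i q -> chart_inv i (chart i q) = q.
Proof. by move=> iq; rewrite chartK// inE. Qed.

Lemma chart_inv_dom i x : (chart i @` chart_dom i) x -> chart_dom i (chart_inv i x).
Proof. by move=> [q iq <-]; rewrite chartKq. Qed.

Lemma chart_invK i x : (chart i @` chart_dom i) x -> chart i (chart_inv i x) = x.
Proof. by move=> [q iq <-]; rewrite chartKq. Qed.

Lemma near_chart_dom i q : chart_dom i q -> nbhs q (chart_dom i).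
Proof. by move=> iq; apply: open_nbhs_nbhs; split=> //; exact: chart_dom_open. Qed.

Lemma near_chart_image i q : chart_dom i q ->
  nbhs (chart i q) (chart i @` chart_dom i).
Proof.
move=> iq; apply: open_nbhs_nbhs; split=> //; exact: chart_codom_open.
Qed.

Lemma near_chart_inv i q (A : set M) : chart_dom i q -> nbhs q A ->
  nbhs (chart i q) (fun x => A (chart_inv i x)).
Proof.
move=> iq nA.
have ciq : (chart i @` chart_dom i) (chart i q) by exists q.
have : chart_inv i y @[y --> chart i q] --> chart_inv i (chart i q).
  exact: chart_inv_continuous ciq.
by rewrite chartKq//; apply.
Qed.

Lemma chart_image_open i (A : set M) : open A ->
  open [set x | (chart i @` chart_dom i) x /\ A (chart_inv i x)].
Proof.
move=> oA; apply: nbhs_open => x [[q iq <-]]; rewrite chartKq// => Aq.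
apply: filterI; first exact: near_chart_image.
by apply: near_chart_inv => //; exact: open_nbhs1.
Qed.

Lemma overlap_open i j : open (chart i @` (chart_dom i `&` chart_dom j)).
Proof.
rewrite (_ : _ @` _ = [set x | (chart i @` chart_dom i) x /\
   chart_dom j (chart_inv i x)]); first exact/chart_image_open/chart_dom_open.
apply/seteqP; split => [_ [q [iq jq] <-]|x [[q iq <-]]] /=.
  by rewrite chartKq//; split => //; exists q.
by rewrite chartKq// => jq; exists q.
Qed.

Lemma near_overlap i j q : chart_dom i q -> chart_dom j q ->
  nbhs (chart i q) (chart i @` (chart_dom i `&` chart_dom j)).
Proof.
by move=> iq jq; apply: open_nbhs_nbhs; split; [exact: overlap_open|exists q].
Qed.

Lemma transition_differentiable i j q : chart_dom i q -> chart_dom j q ->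
  differentiable (chart j \o chart_inv i) (chart i q).
Proof.
move=> iq jq; apply: smooth_on_differentiable (chart_transition_smooth i j) _.
by exists q.
Qed.

Lemma coord_changeP i j q x : chart_dom i q -> chart_dom j q ->
  coord_change q i j x = 'D_x (chart j \o chart_inv i) (chart i q).
Proof. by move=> iq jq; rewrite deriveE//; exact: transition_differentiable. Qed.

Lemma coord_change_id i q x : chart_dom i q -> coord_change q i i x = x.
Proof.
move=> iq; rewrite coord_changeP// -[RHS](derive_id (chart i q) x).
apply: near_eq_derive; apply: filterS (near_chart_image iq) => y iy.
by rewrite /= chart_invK.
Qed.

(** The chain rule for the transition maps. *)
Lemma coord_change_comp i j k q x :
  chart_dom i q -> chart_dom j q -> chart_dom k q ->
  coord_change q j k (coord_change q i j x) = coord_change q i k x.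
Proof.
move=> iq jq kq.
pose f := chart j \o chart_inv i; pose g := chart k \o chart_inv j.
have df : differentiable f (chart i q) by exact: transition_differentiable.
have fq : f (chart i q) = chart j q by rewrite /f/= chartKq.
have dg : differentiable g (f (chart i q)).
  by rewrite fq; exact: transition_differentiable.
rewrite [RHS]coord_changeP//.
transitivity ('D_x (g \o f) (chart i q)).
  by rewrite (derive_comp x df dg) fq.
apply: near_eq_derive; apply: filterS (near_overlap iq jq) => y [p [ip jp] <-].
by rewrite /g /f /= !chartKq.
Qed.

Lemma coord_changeD i j q x y :
  coord_change q i j (x + y) = coord_change q i j x + coord_change q i j y.
Proof. exact: linearD. Qed.

Lemma coord_changeZ i j q a x :
  coord_change q i j (a *: x) = a *: coord_change q i j x.
Proof. exact: linearZ. Qed.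

Lemma coord_change0 i j q : coord_change q i j 0 = 0.
Proof. exact: linear0. Qed.

Lemma tvec_scaleE a v i : (a *: v) i = a *: v i.
Proof. by []. Qed.

Lemma tvec_addE v w i : (v + w) i = v i + w i.
Proof. by []. Qed.

Lemma tangent0 q : tangent q (0 : tvec M).
Proof. by split => // i j iq jq; rewrite coord_change0. Qed.

Lemma tangentZ q v a : tangent q v -> tangent q (a *: v).
Proof.
move=> [vt v0]; split=> [i j iq jq|i iq].
  by rewrite !tvec_scaleE (vt i j)// -coord_changeZ.
by rewrite tvec_scaleE v0// scaler0.
Qed.

Lemma tangentD q v w : tangent q v -> tangent q w -> tangent q (v + w).
Proof.
move=> [vt v0] [wt w0]; split=> [i j iq jq|i iq].
  by rewrite !tvec_addE (vt i j)// (wt i j)// -coord_changeD.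
by rewrite tvec_addE v0// w0// addr0.
Qed.

Lemma tangent_eq q i v w : chart_dom i q -> tangent q v -> tangent q w ->
  v i = w i -> v = w.
Proof.
move=> iq [vt v0] [wt w0] vw; apply/funext => j.
have [jq|jq] := pselect (chart_dom j q); last by rewrite v0// w0.
by rewrite (vt i j)// (wt i j)// vw.
Qed.

Lemma tvec_of_dom q i j x : chart_dom j q -> tvec_of q i x j = coord_change q i j x.
Proof. by move=> jq; rewrite /tvec_of asboolT. Qed.

Lemma tvec_ofE q i x : chart_dom i q -> tvec_of q i x i = x.
Proof. by move=> iq; rewrite tvec_of_dom// coord_change_id. Qed.

Lemma tvec_of_tangent q i x : chart_dom i q -> tangent q (tvec_of q i x).
Proof.
move=> iq; split=> [j k jq kq|j jq].
  by rewrite !tvec_of_dom// coord_change_comp.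
by rewrite /tvec_of asboolF.
Qed.

Lemma tvec_ofK q i v : chart_dom i q -> tangent q v -> tvec_of q i (v i) = v.
Proof.
move=> iq vt; apply: (tangent_eq iq) => //; first exact: tvec_of_tangent.
by rewrite tvec_ofE.
Qed.

Lemma tvec_ofZ q i a x : chart_dom i q -> tvec_of q i (a *: x) = a *: tvec_of q i x.
Proof.
move=> iq; apply: (tangent_eq iq).
- exact: tvec_of_tangent.
- exact/tangentZ/tvec_of_tangent.
- by rewrite tvec_scaleE !tvec_ofE.
Qed.

(** The open sets of M pull back to open sets of the tangent bundle, so
    convergence in the tangent bundle gives convergence of the base points. *)
Lemma TM_cvg_base (q : nat -> M) (v : nat -> tvec M) q0 v0 :
  TM_cvg q v q0 v0 -> q k @[k --> \oo] --> q0.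
Proof.
move=> qv A; rewrite nbhsE => -[B [oB Bq0] BA].
have := qv [set z | B z.1] _ Bq0.
have oBT : TM_open [set z : M * tvec M | B z.1].
  move=> i; apply: nbhs_open => z /= zB.
  have := open_nbhs1 (chart_image_open (i := i) oB) zB.
  exact: (@cvg_fst _ _ (nbhs z.1) (nbhs z.2)).
by move=> /(_ oBT); apply: filterS => k; exact: BA.
Qed.

(** In the bundle chart of j, the coordinates in i of a vector are given by the
    differential of a transition map, which is jointly continuous; hence a
    condition on these coordinates that is open defines an open set of the
    tangent bundle. *)
Lemma TM_cvg_fiber (q : nat -> M) (v : nat -> tvec M) q0 v0 i :
  TM_cvg q v q0 v0 -> tangent q0 v0 -> (forall m, tangent (q m) (v m)) ->
  chart_dom i q0 ->
  v m i @[m --> \oo] --> v0 i.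
Proof.
move=> qv v0t vt iq0 A; rewrite nbhsE => -[B [oB Bv0] BA].
have BT : TM_open [set z : M * tvec M | chart_dom i z.1 /\ B (z.2 i)].
  move=> j; apply: nbhs_open => -[x y] /= [[p jp <-]]; rewrite chartKq// => -[ip].
  rewrite tvec_of_dom// => Bp.
  pose f := chart i \o chart_inv j.
  have : nbhs (chart j p, y) (fun z => B ('d f (z.1) (z.2))).
    have := @smooth_cvg_diff R n _ _ (nbhs (chart j p, y)) _ _ f
       (fun z => z.1) (fun z => z.2) (chart j p) y (@overlap_open j i)
       (@chart_transition_smooth _ _ M j i).
    apply => //; first by exists p.
    - exact: cvg_fst.
    - exact: cvg_snd.
    - by apply: open_nbhs_nbhs.
  have : nbhs (chart j p, y) (fun z => (chart j @` (chart_dom j `&` chart_dom i)) z.1).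
    by apply: cvg_fst; exact: near_overlap.
  apply: filterS2 => -[_ z] /= [q' [jq iq] <-] Bz.
  split; first by exists q'.
  rewrite chartKq//; split=> //; rewrite tvec_of_dom//.
have := qv _ BT (conj iq0 Bv0); apply: filterS => k [_ Bk]; exact: BA.
Qed.

End manifold.

(** * The metric *)

Section metric.
Context {R : realType} {n : nat} (M : riemannian_manifold R n).
Implicit Types (p q : M) (i j k : chart_index M) (u v w : tvec M).

Lemma metric_form_sym i q (x y : 'cV[R]_n) : chart_dom i q ->
  (x^T *m metric i q *m y) 0 0 = (y^T *m metric i q *m x) 0 0.
Proof.
move=> iq.
have <- : (x^T *m metric i q *m y)^T 0 0 = (x^T *m metric i q *m y) 0 0.
  by rewrite mxE.
by rewrite !trmx_mul trmxK (Defs.metric_sym iq) mulmxA.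
Qed.

(** A vector in the kernel would have length zero. *)
Lemma metric_unit i q : chart_dom i q -> metric i q \in unitmx.
Proof.
move=> iq; rewrite -row_free_unit -kermx_eq0; apply: contraT => /rowV0Pn[x].
move=> /sub_kermxP xG x0.
have := @metric_posdef _ _ M i q iq x^T; rewrite trmxK xG mul0mx mxE ltxx.
by rewrite trmx_eq0 => /(_ x0).
Qed.

Lemma metric_continuous i q : chart_dom i q ->
  {for q, continuous (fun p : M => metric i p)}.
Proof.
move=> iq.
have ciq : (chart i @` chart_dom i) (chart i q) by exists q.
have h1 := smooth_on_continuous (metric_smooth i) ciq.
have h2 := chart_continuous iq.
have h3 : metric i (chart_inv i (chart i p)) @[p --> q] -->
    metric i (chart_inv i (chart i q)).
  exact: (cvg_comp _ _ h2 h1).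
rewrite chartKq// in h3; apply: cvg_trans h3; apply: near_eq_cvg.
have := near_chart_dom iq; apply: filterS => p ip.
by rewrite chartKq.
Qed.

Lemma inner_chart i q v w : chart_dom i q -> tangent q v -> tangent q w ->
  inner q v w = ((v i)^T *m metric i q *m w i) 0 0.
Proof.
move=> iq [vt _] [wt _]; have aq := chart_at_dom q.
by rewrite /inner (metric_tensorial aq iq) -vt// -wt.
Qed.

Lemma innerC q v w : inner q v w = inner q w v.
Proof. exact/metric_form_sym/chart_at_dom. Qed.

Lemma innerDl q u v w : inner q (u + v) w = inner q u w + inner q v w.
Proof. by rewrite /inner tvec_addE linearD/= !mulmxDl mxE. Qed.

Lemma innerZl q a v w : inner q (a *: v) w = a * inner q v w.
Proof. by rewrite /inner tvec_scaleE linearZ/= -!scalemxAl mxE. Qed.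

Lemma innerDr q u v w : inner q u (v + w) = inner q u v + inner q u w.
Proof. by rewrite innerC innerDl innerC [inner q w u]innerC. Qed.

Lemma innerZr q a v w : inner q v (a *: w) = a * inner q v w.
Proof. by rewrite innerC innerZl innerC. Qed.

Lemma inner_gt0 q v : v (chart_at q) != 0 -> 0 < inner q v v.
Proof. by move=> v0; apply: metric_posdef => //; exact: chart_at_dom. Qed.

Lemma inner_ge0 q v : 0 <= inner q v v.
Proof.
have [v0|/inner_gt0/ltW//] := eqVneq (v (chart_at q)) 0.
by rewrite /inner v0 mulmx0 mxE.
Qed.

Lemma inner_eq0 q v : tangent q v -> inner q v v = 0 -> v = 0.
Proof.
move=> vt v0; apply: (tangent_eq (chart_at_dom q)) => //; first exact: tangent0.
by apply/eqP; apply: contraT => /inner_gt0; rewrite v0 ltxx.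
Qed.

(** The vector <w, w> v - <v, w> w has a nonnegative square. *)
Lemma inner_CS q v w : inner q v w ^+ 2 <= inner q v v * inner q w w.
Proof.
have [w0|/inner_gt0 w0] := eqVneq (w (chart_at q)) 0.
  by rewrite /inner w0 !mulmx0 mxE expr0n/= mulr0.
have := inner_ge0 q (inner q w w *: v + (- inner q v w) *: w).
rewrite !(innerDl, innerDr, innerZl, innerZr) [inner q w v]innerC.
rewrite (_ : _ + _ = inner q w w * (inner q v v * inner q w w - inner q v w ^+ 2)).
  by rewrite pmulr_rge0// subr_ge0.
by ring.
Qed.

Lemma tnorm_ge0 q v : 0 <= tnorm q v.
Proof. exact: sqrtr_ge0. Qed.

Lemma tnorm_sqr q v : tnorm q v ^+ 2 = inner q v v.
Proof. by rewrite sqr_sqrtr// inner_ge0. Qed.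

Lemma tnormZ q a v : tnorm q (a *: v) = `|a| * tnorm q v.
Proof.
by rewrite /tnorm innerZl innerZr mulrA -expr2 sqrtrM ?sqr_ge0// sqrtr_sqr.
Qed.

Lemma inner_le q v w : `|inner q v w| <= tnorm q v * tnorm q w.
Proof.
rewrite -ler_sqr ?nnegrE ?mulr_ge0 ?tnorm_ge0// exprMn !tnorm_sqr.
by rewrite real_normK ?num_real// inner_CS.
Qed.

End metric.

(** * Velocities of curves *)

Section curves.
Context {R : realType} {n : nat} (M : smooth_manifold R n).
Implicit Types (p q : M) (i j k : chart_index M) (c : R -> M).

Lemma near_curve_dom c t i : {for t, continuous c} -> chart_dom i (c t) ->
  \forall s \near t, chart_dom i (c s).
Proof. by move=> cc ict; exact: (cc _ (near_chart_dom ict)). Qed.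

Lemma velocity_dom c t i : chart_dom i (c t) ->
  velocity c t i = derive1 (chart i \o c) t.
Proof. by move=> ict; rewrite /velocity asboolT. Qed.

(** The chain rule for a transition map: it suffices to differentiate a curve in
    one chart. *)
Lemma derivable_chart_change c t i j : {for t, continuous c} ->
  chart_dom i (c t) -> chart_dom j (c t) -> derivable (chart i \o c) t 1 ->
  derivable (chart j \o c) t 1 /\
  derive1 (chart j \o c) t = coord_change (c t) i j (derive1 (chart i \o c) t).
Proof.
move=> cc ict jct dic.
have df := transition_differentiable ict jct.
have E : {near t, (chart j \o chart_inv i) \o (chart i \o c) =1 chart j \o c}.
  apply: filterS (near_curve_dom cc ict) => s ics.
  by rewrite /= chartKq.
split; first by apply: near_eq_derivable E _; exact: derivable1_comp.
by rewrite -(near_eq_derive1 E) (derive1_comp_diff dic df).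
Qed.

Lemma velocity_tangent c t i : {for t, continuous c} ->
  chart_dom i (c t) -> derivable (chart i \o c) t 1 ->
  tangent (c t) (velocity c t).
Proof.
move=> cc ict dic; split=> [j k jct kct|j jct]; last by rewrite /velocity asboolF.
rewrite !velocity_dom//.
by have [djc _] := derivable_chart_change cc ict jct dic;
   have [] := derivable_chart_change cc jct kct djc.
Qed.

Lemma near_eq_chart c1 c2 (t : R) i : {near t, c1 =1 c2} ->
  {near t, chart i \o c1 =1 chart i \o c2}.
Proof. by apply: filterS => s /= ->. Qed.

Lemma near_eq_velocity c1 c2 (t : R) : {near t, c1 =1 c2} ->
  velocity c1 t = velocity c2 t.
Proof.
move=> E; apply/funext => i; rewrite /velocity (nbhs_singleton E).
by case: asboolP => [_|_]; [exact/near_eq_derive1/near_eq_chart|].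
Qed.

Lemma near_eq_continuous c1 c2 (t : R) : {near t, c1 =1 c2} ->
  {for t, continuous c1} -> {for t, continuous c2}.
Proof.
move=> E; rewrite /prop_for /continuous_at -(nbhs_singleton E).
by apply: cvg_trans; exact: near_eq_cvg.
Qed.

End curves.

(** * Geodesics: reparametrization, speed and uniqueness *)

Section geodesics.
Context {R : realType} {n : nat} (M : riemannian_manifold R n).
Implicit Types (p q : M) (i j k : chart_index M) (c : R -> M) (J : set R).

Lemma geodesic_continuous J c t : geodesic_on J c -> J t -> {for t, continuous c}.
Proof. by move=> gc Jt; have [] := gc t Jt. Qed.

Lemma geodesic_derivable J c t i : geodesic_on J c -> J t -> chart_dom i (c t) ->
  derivable (chart i \o c) t 1.
Proof. by move=> gc Jt ict; have [_ /(_ i ict)[]] := gc t Jt. Qed.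

Lemma geodesic_derivable2 J c t i : geodesic_on J c -> J t -> chart_dom i (c t) ->
  derivable (derive1 (chart i \o c)) t 1.
Proof. by move=> gc Jt ict; have [_ /(_ i ict)[]] := gc t Jt. Qed.

Lemma geodesic_velocity_tangent J c t : geodesic_on J c -> J t ->
  tangent (c t) (velocity c t).
Proof.
move=> gc Jt; have ac := chart_at_dom (c t).
apply: (velocity_tangent _ ac); first exact: geodesic_continuous Jt.
exact: geodesic_derivable gc Jt ac.
Qed.

Lemma geodesic_sub J J' c : J' `<=` J -> geodesic_on J c -> geodesic_on J' c.
Proof. by move=> JJ gc t /JJ; exact: gc. Qed.

Lemma geodesic_near_eq J c1 c2 : open J -> (forall t, J t -> c1 t = c2 t) ->
  geodesic_on J c1 -> geodesic_on J c2.
Proof.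
move=> oJ E gc t Jt.
have nE s : J s -> {near s, c1 =1 c2}.
  by move=> Js; apply: filterS (open_nbhs1 oJ Js); exact: E.
split; first by apply: near_eq_continuous (nE _ Jt) _; exact: geodesic_continuous Jt.
move=> i; rewrite -E// => ict /=.
have [_ /(_ i ict)/= [d1 d2 eq]] := gc t Jt.
have E1 : {near t, derive1 (chart i \o c1) =1 derive1 (chart i \o c2)}.
  apply: filterS (open_nbhs1 oJ Jt) => s Js.
  exact/near_eq_derive1/near_eq_chart/nE.
split.
- exact: near_eq_derivable (near_eq_chart i (nE _ Jt)) d1.
- exact: near_eq_derivable E1 d2.
- move=> a; rewrite -(near_eq_derive1 E1) -(nbhs_singleton E1) -E//.
Qed.

Lemma continuous_affine (a b t : R) : {for t, continuous (fun s : R => a * s + b)}.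
Proof. by apply: continuousD; [exact: mulrl_continuous|exact: cst_continuous]. Qed.

Lemma velocity_affine J c a b t : geodesic_on J c -> J (a * t + b) ->
  velocity (fun s => c (a * s + b)) t = a *: velocity c (a * t + b).
Proof.
move=> gc Jt; apply/funext => i; rewrite tvec_scaleE /velocity.
case: asboolP => [ict|_]; last by rewrite scaler0.
have [_ <-] := derive1_affine (geodesic_derivable gc Jt ict).
by [].
Qed.

(** The acceleration and the quadratic Christoffel term both scale by a^2. *)
Lemma geodesic_affine J c a b : open J -> geodesic_on J c ->
  geodesic_on [set t | J (a * t + b)] (fun s => c (a * s + b)).
Proof.
move=> oJ gc t /= Jt; have ca := @continuous_affine a b t.
have cc : {for t, continuous (fun s => c (a * s + b))}.
  by apply: (continuous_comp ca); exact: (geodesic_continuous gc Jt).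
split=> // i ict /=.
have [_ /(_ i ict)/= [d1 d2 eq]] := gc _ Jt.
have near_t : \forall s \near t, J (a * s + b) /\ chart_dom i (c (a * s + b)).
  apply: filterI; last exact: near_curve_dom.
  by apply: ca; exact: open_nbhs1.
have E1 : {near t, (fun s => a *: derive1 (chart i \o c) (a * s + b)) =1
    derive1 (chart i \o (fun s => c (a * s + b)))}.
  apply: filterS near_t => s [Js ics].
  by have [_ <-] := derive1_affine (geodesic_derivable gc Js ics).
have [d1' e1'] := derive1_affine d1.
have [d2' e2'] := derive1_affine d2.
have d3 : derivable (fun s => a *: derive1 (chart i \o c) (a * s + b)) t 1.
  exact: derivableZ.
split.
- exact: d1'.
- exact: near_eq_derivable E1 d3.
- move=> k; rewrite -(near_eq_derive1 E1) -(nbhs_singleton E1).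
  have -> : derive1 (fun s => a *: derive1 (chart i \o c) (a * s + b)) t =
      a *: (a *: derive1 (derive1 (chart i \o c)) (a * t + b)).
    by rewrite -e2'; exact: derive1Z d2'.
  set y'' := derive1 (derive1 (chart i \o c)) (a * t + b) in eq *.
  set y' := derive1 (chart i \o c) (a * t + b) in eq *.
  set y := (chart i \o c) (a * t + b) in eq.
  have -> : (a *: (a *: y'')) k 0 = a ^+ 2 * y'' k 0 by rewrite !mxE; ring.
  have := congr1 (fun r => a ^+ 2 * r) (eq k).
  rewrite mulr0 mulrDr; apply: etrans; congr (_ + _).
  rewrite [RHS]mulr_sumr; apply: eq_bigr => r _.
  rewrite [RHS]mulr_sumr; apply: eq_bigr => s _; rewrite !mxE.
  by rewrite /y/=; ring.
Qed.

(** The algebra behind the conservation of speed.  With D r a b for the partial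
    derivative in direction r of the entry (a, b) of the metric, u for the
    velocity and w for the acceleration, the sum is the derivative of g(u, u).
    Multiplied by G and paired with u, the geodesic equation makes each of the
    last two sums minus half of S + S - S, where S is the first one: the three
    terms of a Christoffel symbol give the same cubic sum, up to the names of
    the indices. *)
Lemma christoffel_cancel (G : 'M[R]_n) (D : 'I_n -> 'I_n -> 'I_n -> R)
    (u w : 'cV[R]_n) :
  G \in unitmx -> (forall a b, G a b = G b a) ->
  (forall k : 'I_n, w k 0 + \sum_(a < n) \sum_(b < n)
     2^-1 * (\sum_(l < n) invmx G k l * (D a l b + D b l a - D l a b)) *
     u a 0 * u b 0 = 0) ->
  \sum_a \sum_b ((\sum_r u r 0 * D r a b) * u a 0 * u b 0 +
     G a b * w a 0 * u b 0 + G a b * u a 0 * w b 0) = 0.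
Proof.
move=> Gu Gs H.
pose h : 'cV[R]_n := \col_l \sum_a \sum_b
  (D a l b + D b l a - D l a b) * u a 0 * u b 0.
have wE : w = - (2^-1 *: (invmx G *m h)).
  apply/colP => k; have /eqP := H k; rewrite addr_eq0 => /eqP ->.
  rewrite !mxE; congr (- _).
  under [in RHS]eq_bigr do rewrite mxE mulr_sumr.
  rewrite [in RHS]exchange_big mulr_sumr; apply: eq_bigr => a _.
  under [in RHS]eq_bigr do rewrite mulr_sumr.
  rewrite [in RHS]exchange_big mulr_sumr; apply: eq_bigr => b _.
  rewrite !mulr_sumr !mulr_suml; apply: eq_bigr => l _; ring.
have Gw : G *m w = - (2^-1 *: h).
  by rewrite wE mulmxN -scalemxAr mulKVmx.
pose S := \sum_a \sum_b \sum_r D r a b * u r 0 * u a 0 * u b 0.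
have GwE : \sum_a \sum_b G a b * u a 0 * w b 0 = - (2^-1 * S).
  transitivity (\sum_a u a 0 * (G *m w) a 0).
    apply: eq_bigr => a _; rewrite mxE mulr_sumr; apply: eq_bigr => b _; ring.
  rewrite Gw.
  transitivity (- (2^-1 * \sum_l \sum_a \sum_b
    (D a l b + D b l a - D l a b) * u a 0 * u b 0 * u l 0)).
    rewrite mulr_sumr -sumrN; apply: eq_bigr => l _; rewrite !mxE.
    rewrite [in RHS](eq_bigr (fun a => (\sum_b (D a l b + D b l a - D l a b) *
       u a 0 * u b 0) * u l 0)); last by move=> a _; rewrite mulr_suml.
    by rewrite -mulr_suml; ring.
  congr (- (_ * _)).
  have S1 : \sum_l \sum_a \sum_b D a l b * u a 0 * u b 0 * u l 0 = S.
    apply: eq_bigr => l _; rewrite exchange_big; apply: eq_bigr => b _.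
    apply: eq_bigr => a _; ring.
  have S2 : \sum_l \sum_a \sum_b D b l a * u a 0 * u b 0 * u l 0 = S.
    apply: eq_bigr => l _; apply: eq_bigr => a _; apply: eq_bigr => b _; ring.
  have S3 : \sum_l \sum_a \sum_b D l a b * u a 0 * u b 0 * u l 0 = S.
    rewrite exchange_big; apply: eq_bigr => a _.
    rewrite exchange_big; apply: eq_bigr => b _; apply: eq_bigr => l _; ring.
  transitivity (\sum_l \sum_a \sum_b D a l b * u a 0 * u b 0 * u l 0 +
    \sum_l \sum_a \sum_b D b l a * u a 0 * u b 0 * u l 0 -
    \sum_l \sum_a \sum_b D l a b * u a 0 * u b 0 * u l 0); last first.
    by rewrite S1 S2 S3 addrK.
  rewrite -!big_split/= -sumrB; apply: eq_bigr => l _.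
  rewrite -!big_split/= -sumrB; apply: eq_bigr => a _.
  rewrite -!big_split/= -sumrB; apply: eq_bigr => b _; ring.
have GwE' : \sum_a \sum_b G a b * w a 0 * u b 0 = - (2^-1 * S).
  rewrite -GwE exchange_big; apply: eq_bigr => a _; apply: eq_bigr => b _.
  by rewrite Gs; ring.
have -> : \sum_a \sum_b ((\sum_r u r 0 * D r a b) * u a 0 * u b 0 +
     G a b * w a 0 * u b 0 + G a b * u a 0 * w b 0) =
  S + \sum_a \sum_b G a b * w a 0 * u b 0 + \sum_a \sum_b G a b * u a 0 * w b 0.
  rewrite -!big_split/=; apply: eq_bigr => a _.
  rewrite -!big_split/=; apply: eq_bigr => b _; congr (_ + _ + _).
  rewrite !mulr_suml; apply: eq_bigr => r _; ring.
by rewrite GwE GwE'; field.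
Qed.

End geodesics.

Lemma near_neq (R : realType) (V : normedModType R) (f g : R -> V) (s : R) :
  {for s, continuous f} -> {for s, continuous g} -> f s <> g s ->
  \forall r \near s, f r <> g r.
Proof.
move=> cf cg fgs.
have fgs0 : f s - g s != 0 by rewrite subr_eq0; apply/eqP.
have cfg : f r - g r @[r --> s] --> f s - g s by exact: cvgB.
have nr : \forall r \near s, f r - g r != 0 by exact: (cvgr_neq0 _ cfg fgs0).
by apply: filterS nr => r; rewrite subr_eq0 => /eqP.
Qed.

Section geodesic_equation.
Context {R : realType} {n : nat} (M : riemannian_manifold R n).
Implicit Types (p q : M) (i j k : chart_index M) (c : R -> M) (J : set R).

Lemma open_oo (a b : R) : open [set t | a < t < b].
Proof.
apply: nbhs_open => t /= tab.
have : t \in `]a, b[ by rewrite in_itv.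
by move=> /near_in_itvoo; apply: filterS => s; rewrite in_itv.
Qed.

Lemma form_sum (G : 'M[R]_n) (u v : 'cV[R]_n) :
  (u^T *m G *m v) 0 0 = \sum_a \sum_b G a b * u a 0 * v b 0.
Proof.
rewrite mxE exchange_big; apply: eq_bigr => b _; rewrite mxE mulr_suml.
by apply: eq_bigr => a _; rewrite !mxE; ring.
Qed.

(** In a chart the square of the speed is g(x', x'), and its derivative vanishes
    by [christoffel_cancel]. *)
Lemma geodesic_speed_derive J c (t : R) : open J -> geodesic_on J c -> J t ->
  is_derive t 1 (fun s => inner (c s) (velocity c s) (velocity c s)) 0.
Proof.
move=> oJ gc Jt; pose i := chart_at (c t).
have ict : chart_dom i (c t) by exact: chart_at_dom.
pose x := chart i \o c; pose g y := metric i (chart_inv i y).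
have [cc /(_ i ict)/= [d1 d2 eq]] := gc t Jt.
have sg : smooth_on (chart i @` chart_dom i) g by exact: metric_smooth.
have xt : (chart i @` chart_dom i) (x t) by exists (c t).
have E : {near t, (\sum_a \sum_b (fun s => g (x s) a b * derive1 x s a 0 * derive1 x s b 0))
    =1 (fun s => inner (c s) (velocity c s) (velocity c s))}.
  have nt : \forall s \near t, J s /\ chart_dom i (c s).
    exact: filterI (open_nbhs1 oJ Jt) (near_curve_dom cc ict).
  apply: filterS nt => s [Js ics].
  have vt := geodesic_velocity_tangent gc Js.
  rewrite (inner_chart ics vt vt) velocity_dom// form_sum fct_sumE.
  apply: eq_bigr => a _; rewrite fct_sumE; apply: eq_bigr => b _.
  by rewrite /g /x/= chartKq.
pose D (r a b : 'I_n) := 'D_(delta_mx r 0) (fun y => g y a b) (x t).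
pose u := derive1 x t; pose w := derive1 (derive1 x) t.
apply: near_eq_is_derive E _.
have dg (a b : 'I_n) : is_derive t 1 (fun s => g (x s) a b) (\sum_r u r 0 * D r a b).
  have dgx : differentiable (fun y => g y a b) (x t).
    exact: smooth_differentiable_coord sg xt.
  have H := derivable1_comp d1 dgx.
  have := derive1_comp_diff d1 dgx; rewrite diff_col//.
  move=> <-; rewrite derive1E; exact/derivableP.
have dx a : is_derive t 1 (fun s => derive1 x s a 0) (w a 0).
  exact: is_derive1_coord.
have <- : \sum_a \sum_b ((\sum_r u r 0 * D r a b) * u a 0 * u b 0 +
     g (x t) a b * w a 0 * u b 0 + g (x t) a b * u a 0 * w b 0) = 0.
  apply: christoffel_cancel.
  - by rewrite /g /x/= chartKq//; exact: metric_unit.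
  - move=> a b; rewrite /g /x/= chartKq//.
    by rewrite -{1}(Defs.metric_sym ict) mxE.
  - exact: eq.
apply: is_derive_sumr => a; apply: is_derive_sumr => b.
have := dg a b; have := dx a; have := dx b.
move=> dxb dxa dgab; apply: is_derive_eq.
by rewrite /GRing.scale/= -/u; ring.
Qed.

Lemma geodesic_speed c (a b s t : R) : geodesic_on [set t | a < t < b] c ->
  a < s < b -> a < t < b ->
  inner (c s) (velocity c s) (velocity c s) =
  inner (c t) (velocity c t) (velocity c t).
Proof.
move=> gc.
pose f s := inner (c s) (velocity c s) (velocity c s).
have df (r : R) : a < r < b -> is_derive r 1 f 0.
  by move=> rab; exact: (@geodesic_speed_derive _ c r (@open_oo a b) gc rab).
exact: (derive0_const df).
Qed.

Lemma christoffel_loclip i p (l a b : 'I_n) : chart_dom i p ->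
  loclip (fun x : 'cV[R]_n => @christoffel _ _ M i x l a b) (chart i p).
Proof.
move=> ip; have oI := @chart_codom_open _ _ M i.
have ipI : (chart i @` chart_dom i) (chart i p) by exists p.
have sg := @metric_smooth _ _ M i.
have lg r s : loclip (fun x => metric i (chart_inv i x) r s) (chart i p).
  exact: smooth_loclip oI sg ipI.
have lD (v : 'cV[R]_n) r s :
    loclip (fun x => 'D_v (fun y => metric i (chart_inv i y) r s) x) (chart i p).
  apply: (loclip_near_eq (f := fun x => 'D_v (fun y => metric i (chart_inv i y)) x r s)).
    apply: filterS (open_nbhs1 oI ipI) => y Iy.
    by rewrite (smooth_derive_coord _ _ _ sg).
  exact: smooth_loclip oI (smooth_onD v sg) ipI.
rewrite /christoffel; apply: loclipM; first exact: loclip_cst.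
apply: loclip_sum => m; apply: loclipM.
  apply: (loclip_invmx (A := fun x => metric i (chart_inv i x))) => //.
  by rewrite chartKq//; exact: metric_unit.
apply: loclipD; first exact: loclipD.
exact: loclipN.
Qed.

(** In a chart, the differences of positions and of velocities satisfy a linear
    differential inequality, since the right-hand side of the geodesic equation
    is locally Lipschitz in position and velocity; [ode_zero] applies. *)
Lemma geodesic_local_unique J c1 c2 (t0 : R) : open J ->
  geodesic_on J c1 -> geodesic_on J c2 -> J t0 -> c1 t0 = c2 t0 ->
  velocity c1 t0 = velocity c2 t0 -> {near t0, c1 =1 c2}.
Proof.
move=> oJ g1 g2 Jt0 c12 v12; pose i := chart_at (c1 t0).
have i1 : chart_dom i (c1 t0) by exact: chart_at_dom.
have i2 : chart_dom i (c2 t0) by rewrite -c12.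
have cc1 := geodesic_continuous g1 Jt0; have cc2 := geodesic_continuous g2 Jt0.
pose x1 := chart i \o c1; pose x2 := chart i \o c2.
have nJ : \forall t \near t0, [/\ J t, chart_dom i (c1 t) & chart_dom i (c2 t)].
  have nt : \forall t \near t0, J t /\ (chart_dom i (c1 t) /\ chart_dom i (c2 t)).
    exact: filterI (open_nbhs1 oJ Jt0)
      (filterI (near_curve_dom cc1 i1) (near_curve_dom cc2 i2)).
  by apply: filterS nt => t [? []].
pose X := ('cV[R]_n * 'cV[R]_n)%type.
pose phi (m : 'I_n) (z : X) := \sum_(a < n) \sum_(b < n)
   @christoffel _ _ M i z.1 m a b * z.2 a 0 * z.2 b 0.
have lphi m : loclip (phi m) (x1 t0, derive1 x1 t0).
  apply: loclip_sum => a; apply: loclip_sum => b; apply: loclipM; [apply: loclipM|].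
  - apply: (@loclip_comp _ _ _ (fun z : X => z.1) (fun x => @christoffel _ _ M i x m a b)).
      by move=> y z; rewrite [leRHS]prod_normE le_max lexx.
    exact: christoffel_loclip.
  - apply: (@loclip_comp _ _ _ (fun z : X => z.2) (fun x => x a 0)).
      by move=> y z; rewrite [leRHS]prod_normE le_max lexx orbT.
    exact: loclip_coord.
  - apply: (@loclip_comp _ _ _ (fun z : X => z.2) (fun x => x b 0)).
      by move=> y z; rewrite [leRHS]prod_normE le_max lexx orbT.
    exact: loclip_coord.
pose X1 (t : R) : X := (x1 t, derive1 x1 t); pose X2 (t : R) : X := (x2 t, derive1 x2 t).
have x12 : x2 t0 = x1 t0 by rewrite /x1 /x2/= c12.
have x12' : derive1 x2 t0 = derive1 x1 t0.
  by rewrite -(velocity_dom i1) -(velocity_dom i2) v12.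
have cx1 : x1 t @[t --> t0] --> x1 t0.
  exact: (derivable1_continuous (geodesic_derivable g1 Jt0 i1)).
have cx1' : derive1 x1 t @[t --> t0] --> derive1 x1 t0.
  exact: (derivable1_continuous (geodesic_derivable2 g1 Jt0 i1)).
have cx2 : x2 t @[t --> t0] --> x2 t0.
  exact: (derivable1_continuous (geodesic_derivable g2 Jt0 i2)).
have cx2' : derive1 x2 t @[t --> t0] --> derive1 x2 t0.
  exact: (derivable1_continuous (geodesic_derivable2 g2 Jt0 i2)).
rewrite x12 in cx2; rewrite x12' in cx2'.
have cX1 := cvg_pair cx1 cx1'; have cX2 := cvg_pair cx2 cx2'.
(* The components of the difference of the two states: positions (inl) and
   velocities (inr). *)
pose z (m : 'I_n + 'I_n) (t : R) := match m with
  | inl a => x1 t a 0 - x2 t a 0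
  | inr a => derive1 x1 t a 0 - derive1 x2 t a 0 end.
pose z' (m : 'I_n + 'I_n) (t : R) := match m with
  | inl a => derive1 x1 t a 0 - derive1 x2 t a 0
  | inr a => derive1 (derive1 x1) t a 0 - derive1 (derive1 x2) t a 0 end.
have Xz t : `|X1 t - X2 t| <= \sum_m `|z m t|.
  rewrite prod_normE ge_max/= big_sumType/=; apply/andP; split.
    apply: (le_trans (mx_dist_le_sum _ _)).
    by rewrite lerDl sumr_ge0.
  apply: (le_trans (mx_dist_le_sum _ _)).
  by rewrite lerDr sumr_ge0.
pose K m := projT1 (cid2 (lphi m)).
have K0 m : 0 <= K m by rewrite /K; case: cid2.
have HK : \forall t \near t0, forall m, `|phi m (X1 t) - phi m (X2 t)| <= K m * `|X1 t - X2 t|.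
  suff H : forall m, \forall t \near t0, `|phi m (X1 t) - phi m (X2 t)| <= K m * `|X1 t - X2 t|.
    exact: (filter_forall _ H).
  move=> m.
  rewrite /K; case: cid2 => /= k _ [[A B] [/= nA nB] AB].
  have nt : \forall t \near t0, A (X1 t) /\ B (X2 t).
    by apply: filterI; [exact: cX1|exact: cX2].
  by apply: filterS nt => t [At Bt]; exact: (AB (X1 t, X2 t)).
have z0 t : 0 <= \sum_m `|z m t| by apply: sumr_ge0.
have S0 : 0 <= \sum_m K m by apply: sumr_ge0 => m _; exact: K0.
have zle m t : `|z m t| <= \sum_m `|z m t|.
  by rewrite (bigD1 m)//= lerDl sumr_ge0.
have Kle m : K m <= \sum_m K m.
  by rewrite (bigD1 m)//= lerDl sumr_ge0// => k _; exact: K0.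
have aux (r1 r2 s1 s2 : R) : r1 + s1 = 0 -> r2 + s2 = 0 -> r1 - r2 = s2 - s1.
  by lra.
have Z : \forall t \near t0, forall m, z m t = 0.
  apply: (@ode_zero _ _ z z' (1 + \sum_m K m) t0).
  - apply: filterS nJ => t [Jt i1t i2t] [a|a] /=.
      apply: is_deriveB; apply: is_derive1_coord.
        exact: geodesic_derivable g1 Jt i1t.
      exact: geodesic_derivable g2 Jt i2t.
    apply: is_deriveB; apply: is_derive1_coord.
      exact: geodesic_derivable2 g1 Jt i1t.
    exact: geodesic_derivable2 g2 Jt i2t.
  - apply: filterS2 nJ HK => t [Jt i1t i2t] HKt m.
    rewrite mulrDl mul1r; case: m => [a|a].
      by apply: (le_trans (zle (inr a) t)); rewrite lerDl mulr_ge0 ?S0 ?z0.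
    have [_ /(_ i i1t)/= [_ _ /(_ a) eq1]] := g1 t Jt.
    have [_ /(_ i i2t)/= [_ _ /(_ a) eq2]] := g2 t Jt.
    have e : z' (inr a) t = phi a (X2 t) - phi a (X1 t) by exact: aux eq1 eq2.
    apply: (@le_trans _ _ `|z' (inr a) t|); first exact: lexx.
    rewrite e distrC.
    apply: le_trans (HKt a) _.
    rewrite (le_trans (ler_wpM2l (K0 a) (Xz t)))//.
    by rewrite ler_wpDl ?z0// ler_wpM2r ?z0 ?Kle.
  - by case=> a; rewrite /z ?x12 ?x12' subrr.
apply: filterS2 nJ Z => t [Jt i1t i2t] Zt.
rewrite -(chartKq i1t) -(chartKq i2t); congr (chart_inv i _).
apply/colP => a; apply/eqP; rewrite -subr_eq0; apply/eqP.
exact: (Zt (inl a)).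
Qed.

End geodesic_equation.

Section uniqueness.
Context {R : realType} {n : nat} (M : riemannian_manifold R n).
Implicit Types (p q : M) (i j k : chart_index M) (c : R -> M) (J : set R).

(** The times at which positions and velocities agree form a set that is open by
    local uniqueness, and whose complement is open by continuity and because M is
    Hausdorff; an interval is connected. *)
Lemma geodesic_unique (a b t0 t : R) c1 c2 :
  geodesic_on [set t | a < t < b] c1 -> geodesic_on [set t | a < t < b] c2 ->
  a < t0 < b -> c1 t0 = c2 t0 -> velocity c1 t0 = velocity c2 t0 ->
  a < t < b -> c1 t = c2 t.
Proof.
move=> g1 g2 t0ab c12 v12 tab; set J := [set t | a < t < b] in g1 g2.
have oJ : open J by exact: open_oo.
pose S := [set s | J s /\ c1 s = c2 s /\ velocity c1 s = velocity c2 s].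
have oS : open S.
  apply: nbhs_open => s [Js [cs vs]].
  have E := geodesic_local_unique oJ g1 g2 Js cs vs.
  have E2 : \forall r \near s, {near r, c1 =1 c2} by exact/near_join.
  have := open_nbhs1 oJ Js; move: E2; apply: filterS2 => r Er Jr.
  split; first exact: Jr.
  by split; [exact: (nbhs_singleton Er)|exact: near_eq_velocity Er].
have oS' : open (J `\` S).
  apply: nbhs_open => s [Js Ss].
  have nJ := open_nbhs1 oJ Js.
  have cc1 := geodesic_continuous g1 Js; have cc2 := geodesic_continuous g2 Js.
  have [cs|cs] := pselect (c1 s = c2 s); last first.
    have := @carrier_hausdorff _ _ M; rewrite open_hausdorff.
    move=> /(_ (c1 s) (c2 s) (introN eqP cs)) [[A B]].
    rewrite /= !inE => -[As Bs] [oA oB AB].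
    have nA : \forall r \near s, A (c1 r) by apply: cc1; exact: open_nbhs1.
    have nB : \forall r \near s, B (c2 r) by apply: cc2; exact: open_nbhs1.
    near=> r; split; first by near: r.
    move=> [_ [cr _]]; have Ar : A (c1 r) by near: r.
    have Br : B (c2 r) by near: r.
    have : (A `&` B) (c1 r) by split => //; rewrite cr.
    by rewrite AB.
  pose i := chart_at (c1 s).
  have i1 : chart_dom i (c1 s) by exact: chart_at_dom.
  have i2 : chart_dom i (c2 s) by rewrite -cs.
  have vs : derive1 (chart i \o c1) s <> derive1 (chart i \o c2) s.
    move=> vs; apply: Ss; split; [exact: Js|split; first exact: cs].
    have t1 := geodesic_velocity_tangent g1 Js.
    have t2 := geodesic_velocity_tangent g2 Js; rewrite -cs in t2.
    by apply: (tangent_eq i1 t1 t2); rewrite !velocity_dom.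
  have d1 := derivable1_continuous (geodesic_derivable2 g1 Js i1).
  have d2 := derivable1_continuous (geodesic_derivable2 g2 Js i2).
  have nv : \forall r \near s,
      derive1 (chart i \o c1) r <> derive1 (chart i \o c2) r.
    exact: (near_neq d1 d2 vs).
  have nr : \forall r \near s, J r /\
     (derive1 (chart i \o c1) r <> derive1 (chart i \o c2) r /\
     (chart_dom i (c1 r) /\ chart_dom i (c2 r))).
    exact: filterI nJ (filterI nv (filterI (near_curve_dom cc1 i1) (near_curve_dom cc2 i2))).
  apply: filterS nr => r [Jr [nvr [i1r i2r]]]; split; [exact: Jr|case=> _ [_ vr]].
  by apply: nvr; rewrite -(velocity_dom i1r) -(velocity_dom i2r) vr.
have Jc : connected J.
  apply/connected_intervalP => x y /= /andP[ax _] /andP[_ yb] r /andP[xr ry].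
  by rewrite /J/= (lt_le_trans ax xr) (le_lt_trans ry yb).
have SJ : S = J.
  apply: Jc.
  - by exists t0; split; [exact: t0ab|split; [exact: c12|exact: v12]].
  - by exists S; [exact: oS|apply/esym/setIidr => s []].
  - exists (~` (J `\` S)); first exact: open_closedC.
    apply/seteqP; split => [s Ss|s [Js nSs]].
      by split; [case: Ss|case].
    by apply: contrapT => nS; apply: nSs.
have : S t by rewrite SJ.
by case=> _ [].
Unshelve. all: by end_near. Qed.

End uniqueness.

(** * The exponential map and the lengths of geodesics *)

Section exponential.
Context {R : realType} {n : nat} (M : riemannian_manifold R n).
Implicit Types (p q : M) (i j k : chart_index M) (c : R -> M) (v w : tvec M).

(** [expmap] picks some value of [exp_graph]; uniqueness lets any geodesic with the
    right initial data compute it. *)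
Lemma exp_graph_unique q v p1 p2 :
  exp_graph q v p1 -> exp_graph q v p2 -> p1 = p2.
Proof.
move=> [c1 [[e1 e10 g1] c10 v10 <-]] [c2 [[e2 e20 g2] c20 v20 <-]].
pose e := Num.min e1 e2.
have e0 : 0 < e by rewrite lt_min e10.
have [ee1 ee2] : e <= e1 /\ e <= e2 by rewrite !ge_min !lexx orbT.
have {}g1 : geodesic_on [set t | - e < t < 1 + e] c1.
  by apply: geodesic_sub g1 => t /=; lra.
have {}g2 : geodesic_on [set t | - e < t < 1 + e] c2.
  by apply: geodesic_sub g2 => t /=; lra.
apply: (geodesic_unique (t0 := 0) g1 g2).
- lra.
- by rewrite c10.
- by rewrite v10.
- lra.
Qed.

Lemma expmapE q v p : exp_graph q v p -> expmap q v = p.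
Proof.
move=> gp; apply: (exp_graph_unique _ gp).
by rewrite /expmap; apply: (xgetPex q (ex_intro _ p gp)).
Qed.

(** The geodesic with initial velocity t v is the geodesic with initial velocity
    v run at speed t, so that t |-> exp_q (t v) is the geodesic itself. *)
Lemma exp_geodesic q v : exp_dom q v ->
  [/\ exists2 e : R, 0 < e &
        geodesic_on [set t | - e < t < 1 + e] (fun t => expmap q (t *: v)),
      expmap q (0 *: v) = q & velocity (fun t : R => expmap q (t *: v)) 0 = v].
Proof.
move=> [vt [p [c [[e e0 gc] c0 v0 c1]]]].
have oJ := @open_oo R (- e) (1 + e).
have J0 : [set t | - e < t < 1 + e] 0 by clear -e0; rewrite /=; lra.
have E t : [set t | - e < t < 1 + e] t -> c t = expmap q (t *: v).
  move=> /= te; apply/esym/expmapE.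
  have [d d0 Hd] := affine_window J0 te.
  have g' := geodesic_affine (a := t) (b := 0) oJ gc.
  exists (fun s => c (t * s + 0)); split.
  - exists d => //; apply: geodesic_sub g' => s /= /Hd.
    by rewrite subr0.
  - by rewrite mulr0 add0r.
  - rewrite (velocity_affine gc); last by rewrite /= mulr0 add0r.
    by rewrite mulr0 add0r v0.
  - by rewrite mulr1 addr0.
split; last 2 first.
- by rewrite -E.
- rewrite -[RHS]v0; apply/esym/near_eq_velocity.
  by apply: filterS (open_nbhs1 oJ J0) => t /E.
- by exists e => //; exact: geodesic_near_eq oJ E gc.
Qed.

Lemma geodesic_C1_arc (e : R) c : 0 < e -> geodesic_on [set t | - e < t < 1 + e] c ->
  C1_arc c.
Proof.
move=> e0 gc; exists e => // t te; split; first exact: geodesic_continuous gc te.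
move=> i ict; split; first exact: geodesic_derivable gc te ict.
exact/derivable1_continuous/(geodesic_derivable2 gc te ict).
Qed.

Lemma arc_length_geodesic (e : R) c : 0 < e -> geodesic_on [set t | - e < t < 1 + e] c ->
  arc_length c = (tnorm (c 0) (velocity c 0))%:E.
Proof.
move=> e0 gc; rewrite /arc_length.
transitivity (\int[lebesgue_measure]_(t in `[0%R, 1%R])
   (cst (tnorm (c 0) (velocity c 0))%:E t))%E.
  have J0 : - e < 0 < 1 + e by clear -e0; lra.
  apply: eq_integral => t; rewrite inE/= in_itv/= => t01; congr (_%:E).
  have Jt : - e < t < 1 + e by clear -e0 t01; lra.
  by rewrite /tnorm (geodesic_speed gc Jt J0).
rewrite integral_cst//= lebesgue_measure_itv/= lte_fin ltr01.
by rewrite oppr0 adde0 mule1.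
Qed.

Lemma gdist_le p q l : curve_length p q l -> (gdist p q <= l)%E.
Proof. by move=> pql; exact: ereal_inf_lbound. Qed.

(** Reversed pieces (t < s) are allowed: this is how the symmetry of the distance
    enters. *)
Lemma geodesic_curve_length (a b s t : R) c : geodesic_on [set t | a < t < b] c ->
  a < s < b -> a < t < b ->
  curve_length (c s) (c t) (`|t - s| * tnorm (c s) (velocity c s))%:E.
Proof.
move=> gc sab tab; have oJ := @open_oo R a b.
have g' := geodesic_affine (a := t - s) (b := s) oJ gc.
pose c' r := c ((t - s) * r + s).
have [e e0 ge] : exists2 e : R, 0 < e & geodesic_on [set t | - e < t < 1 + e] c'.
  have [e e0 He] := affine_window sab tab.
  by exists e => //; apply: geodesic_sub g' => r /= /He.
have c'0 : c' 0 = c s by rewrite /c' mulr0 add0r.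
have c'1 : c' 1 = c t by rewrite /c' mulr1 subrK.
have vc' : velocity c' 0 = (t - s) *: velocity c s.
  by rewrite (velocity_affine gc) mulr0 add0r.
have := arc_length_geodesic e0 ge; rewrite vc' c'0 tnormZ => <-.
by rewrite -c'0 -c'1; apply: curve_arc; exact: geodesic_C1_arc ge.
Qed.

Lemma normal_domain_geodesic q V v : normal_domain q V -> V v ->
  [/\ exists2 e : R, 0 < e &
        geodesic_on [set t | - e < t < 1 + e] (fun t => expmap q (t *: v)),
      expmap q (0 *: v) = q & velocity (fun t : R => expmap q (t *: v)) 0 = v].
Proof. by move=> [_ _ _ [Ve _ _ _ _] _] /Ve; exact: exp_geodesic. Qed.

Lemma normal_domain_gdist q V v : normal_domain q V -> V v ->
  gdist q (expmap q v) = (tnorm q v)%:E.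
Proof.
move=> nV Vv; have [[e e0 ge] E0 v0] := normal_domain_geodesic nV Vv.
have [_ _ _ _ /(_ v Vv)] := nV.
by rewrite /minimizing (arc_length_geodesic e0 ge) v0 E0 scale1r.
Qed.

(** If there were no largest normal domain, [Vmax] would be empty. *)
Lemma Vmax_normal q p : Umax q p -> normal_domain q (Vmax q).
Proof.
move=> [v Vv _]; move: Vv; rewrite /Vmax.
by case: xgetP => [V -> [nV _] _ //|_ []].
Qed.

Lemma logmapP q p : Umax q p -> Vmax q (logmap q p) /\ expmap q (logmap q p) = p.
Proof.
move=> [v Vv vp]; rewrite /logmap /logmap_on.
exact: (xgetPex 0 (ex_intro (fun v => Vmax q v /\ expmap q v = p) v (conj Vv vp))).
Qed.

Lemma logmap_tangent q p : Umax q p -> tangent q (logmap q p).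
Proof.
move=> Uqp; have [Vl _] := logmapP Uqp.
by have [[Vt _] _ _ _ _] := Vmax_normal Uqp; exact: Vt.
Qed.

Lemma gdist_logmap q p : Umax q p -> gdist q p = (tnorm q (logmap q p))%:E.
Proof.
move=> Uqp; have [Vl {1}<-] := logmapP Uqp.
exact: normal_domain_gdist (Vmax_normal Uqp) Vl.
Qed.

End exponential.

(** * Short chart segments *)

Section corner.
Context {R : realType} {n : nat} (M : riemannian_manifold R n).
Implicit Types (p q : M) (i j k : chart_index M) (c : R -> M) (v w : tvec M).

(** The segment is prolonged to times in (-1, 2), so that it is differentiable on
    an open interval around [0, 1]. *)
Lemma segm_ball (a b x : 'cV[R]_n) (r t : R) : `|x - a| < r -> `|x - b| < r -> -1 < t < 2 ->
  `|x - segm a b t| < 4 * r.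
Proof.
move=> xa xb t12; rewrite sub_segm.
apply: (le_lt_trans (ler_normD _ _)); rewrite !normrZ.
have r0 : 0 < r by exact: le_lt_trans xa.
have t1 : `|1 - t| < 2 by rewrite ltr_norml; lra.
have t2 : `|t| < 2 by rewrite ltr_norml; lra.
have : `|1 - t| * `|x - a| < 2 * r by exact: ltr_pM.
have : `|t| * `|x - b| < 2 * r by exact: ltr_pM.
lra.
Qed.

Lemma segm_curve i (a b : 'cV[R]_n) (t : R) :
  (chart i @` chart_dom i) (segm a b t) ->
  let c s := chart_inv i (segm a b s) in
  [/\ {for t, continuous c},
      velocity c t i = b - a &
      forall j, chart_dom j (c t) ->
        derivable (chart j \o c) t 1 /\
        {for t, continuous (derive1 (chart j \o c))}].
Proof.
move=> It c.
have cc : {for t, continuous c}.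
  apply: (continuous_comp (@continuous_segm _ _ a b t)).
  exact: chart_inv_continuous It.
have ict : chart_dom i (c t) by exact: chart_inv_dom.
have oI := @chart_codom_open _ _ M i.
have Id : \forall s \near t, (chart i @` chart_dom i) (segm a b s).
  by apply: continuous_segm; exact: open_nbhs1.
split => //.
  rewrite velocity_dom// -(derive1_segm a b t); apply: near_eq_derive1.
  by apply: filterS Id => s Is; rewrite /c/= chart_invK.
move=> j jct; pose f := chart j \o chart_inv i.
have oO := @overlap_open _ _ M i j.
have sf : smooth_on (chart i @` (chart_dom i `&` chart_dom j)) f.
  exact: chart_transition_smooth.
have Ot : (chart i @` (chart_dom i `&` chart_dom j)) (segm a b t).
  by exists (c t) => //; rewrite /c chart_invK.
have Od : \forall s \near t, (chart i @` (chart_dom i `&` chart_dom j)) (segm a b s).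
  by apply: continuous_segm; exact: open_nbhs1.
have df s : (chart i @` (chart_dom i `&` chart_dom j)) (segm a b s) ->
    differentiable f (segm a b s).
  by exact: smooth_on_differentiable.
have -> : chart j \o c = f \o segm a b by [].
split; first exact: (derivable1_comp (@derivable_segm _ _ a b t) (df t Ot)).
have E : \forall s \near t, derive1 (f \o segm a b) s = 'd f (segm a b s) (b - a).
  apply: filterS Od => s /df dfs; rewrite -(derive1_segm a b s).
  exact: (derive1_comp_diff (@derivable_segm _ _ a b s) dfs).
have C : 'd f (segm a b s) (b - a) @[s --> t] --> 'd f (segm a b t) (b - a).
  apply: smooth_cvg_diff oO sf Ot _ _; first exact: continuous_segm.
  exact: cvg_cst.
rewrite /prop_for /continuous_at (nbhs_singleton E).
by apply: cvg_trans C; apply: near_eq_cvg; apply: filterS E => s /esym.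
Qed.

(** To first order, the length of a short chart segment from a to b near p is the
    norm of b - a for the metric frozen at p.  The bound is stated for the
    direction (b - a) / d, with d a length scale, because the direction has a
    limit W when a corner is cut at smaller and smaller scales. *)
Lemma chord_length i p (W : 'cV[R]_n) (K : R) : chart_dom i p -> 0 <= K ->
  (W^T *m metric i p *m W) 0 0 < K ^+ 2 ->
  exists2 r : R, 0 < r & forall (a b : 'cV[R]_n) (d : R),
    `|chart i p - a| < r -> `|chart i p - b| < r -> 0 < d ->
    `|W - d^-1 *: (b - a)| < r ->
    exists2 l, curve_length (chart_inv i a) (chart_inv i b) l &
      (l <= (d * K)%:E)%E.
Proof.
move=> ip K0 WK; pose g y := metric i (chart_inv i y).
have sg : smooth_on (chart i @` chart_dom i) g by exact: metric_smooth.
have ipI : (chart i @` chart_dom i) (chart i p) by exists p.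
have oI := @chart_codom_open _ _ M i.
pose Phi (z : 'cV[R]_n * 'cV[R]_n) := (z.2^T *m g z.1 *m z.2) 0 0.
have cPhi : Phi z @[z --> (chart i p, W)] --> Phi (chart i p, W).
  apply: cvg_coord; apply: cvg_mulmx; last exact: cvg_snd.
  apply: cvg_mulmx; first by apply: cvg_trmx; exact: cvg_snd.
  apply: (@cvg_comp _ _ _ fst g); first exact: cvg_fst.
  exact: (smooth_on_continuous sg ipI).
(* The bound holds for the metric at p; by continuity it persists for nearby
   points and directions. *)
have nPhi : \forall z \near (chart i p, W), Phi z < K ^+ 2.
  have : nbhs (Phi (chart i p, W)) [set x | x < K ^+ 2].
    by apply: open_nbhs1; [exact: open_lt|rewrite /= /Phi/= /g chartKq].
  exact: cPhi.
have nI : \forall z \near (chart i p, W), (chart i @` chart_dom i) z.1.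
  have nIp := open_nbhs1 oI ipI.
  exact: (@cvg_fst _ _ (nbhs (chart i p)) (nbhs W)).
have [e /= e0 be] := (nbhs_ballP (chart i p, W) _).1 (filterI nPhi nI).
have {}be x U : `|chart i p - x| < e -> `|W - U| < e ->
    (chart i @` chart_dom i) x /\ Phi (x, U) < K ^+ 2.
  move=> xe Ue; have [] := be (x, U); last by [].
  by split; rewrite -ball_normE.
have PhiZ x u (d : R) : Phi (x, d *: u) = d ^+ 2 * (u^T *m g x *m u) 0 0.
  rewrite /Phi/= !form_sum mulr_sumr; apply: eq_bigr => k _.
  by rewrite mulr_sumr; apply: eq_bigr => l _; rewrite !mxE; ring.
exists (e / 4); first by rewrite divr_gt0.
move=> a b d ar br d0 Wr.
pose c s := chart_inv i (segm a b s).
have Wd : `|W - d^-1 *: (b - a)| < e by lra.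
have sI (t : R) : -1 < t < 2 -> (chart i @` chart_dom i) (segm a b t) /\
    Phi (segm a b t, d^-1 *: (b - a)) < K ^+ 2.
  move=> t12; apply: be => //.
  by have := segm_ball ar br t12; rewrite mulrC divfK.
have cC1 : C1_arc c.
  exists 1; first exact: ltr01.
  move=> t t12; have t12' : -1 < t < 2 by lra.
  have [It _] := sI t t12'.
  by have [cc _ cj] := segm_curve It.
have c0 : c 0 = chart_inv i a by rewrite /c segm0.
have c1 : c 1 = chart_inv i b by rewrite /c segm1.
exists (arc_length c); first by rewrite -c0 -c1; exact: curve_arc.
have sp (t : R) : -1 < t < 2 -> tnorm (c t) (velocity c t) =
    d * Num.sqrt (Phi (segm a b t, d^-1 *: (b - a))).
  move=> t12; have [It _] := sI t t12; have [cc vc cj] := segm_curve It.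
  have ict : chart_dom i (c t) by exact: chart_inv_dom.
  have tv : tangent (c t) (velocity c t).
    by apply: (velocity_tangent cc ict); have [] := cj i ict.
  rewrite /tnorm (inner_chart ict tv tv) vc.
  rewrite PhiZ -{1}(@ger0_norm _ d) ?ltW// -sqrtr_sqr -sqrtrM ?sqr_ge0//.
  by rewrite mulrA -exprMn divff ?gt_eqF// expr1n mul1r.
have csp : {within `[(0:R), 1], continuous (fun t => tnorm (c t) (velocity c t))}.
  apply: continuous_in_subspaceT => t; rewrite inE/= in_itv/= => t01.
  have t12 : -1 < t < 2 by lra.
  have [It _] := sI t t12.
  have E : \forall s \near t, d * Num.sqrt (Phi (segm a b s, d^-1 *: (b - a))) =
      tnorm (c s) (velocity c s).
    have : \forall s \near t, -1 < s < 2 by exact: (open_nbhs1 (@open_oo R (-1) 2)).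
    by apply: filterS => s /sp.
  have C : d * Num.sqrt (Phi (segm a b s, d^-1 *: (b - a))) @[s --> t] -->
      d * Num.sqrt (Phi (segm a b t, d^-1 *: (b - a))).
    apply: cvgMr; apply: (@cvg_comp _ _ _ _ Num.sqrt); last exact: sqrt_continuous.
    have Cg : g (segm a b s) @[s --> t] --> g (segm a b t).
      apply: (@cvg_comp _ _ _ (segm a b) g); first exact: continuous_segm.
      exact: (smooth_on_continuous sg It).
    apply: cvg_coord; apply: cvg_mulmx; last exact: (cvg_cst (d^-1 *: (b - a))).
    by apply: cvg_mulmx => //; exact: (cvg_cst (d^-1 *: (b - a))^T).
  rewrite /continuous_at sp//; apply: cvg_trans C; exact: near_eq_cvg.
rewrite /arc_length; apply: (@le_trans _ _
  (\int[lebesgue_measure]_(t in `[0%R, 1%R]) (cst (d * K)%:E t))%E).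
  apply: ge0_le_integral => //.
  - by move=> t _; rewrite lee_fin tnorm_ge0.
  - apply/measurable_EFinP; apply: subspace_continuous_measurable_fun; last exact: csp.
    exact: measurable_itv.
  - move=> t /=; rewrite in_itv/= => t01; have t12 : -1 < t < 2 by lra.
    have [_ /ltW PK] := sI t t12.
    rewrite lee_fin sp//; apply: ler_wpM2l; first exact: ltW.
    by rewrite -[leRHS](ger0_norm K0) -sqrtr_sqr; exact: ler_wsqrtr.
rewrite integral_cst//= lebesgue_measure_itv/= lte_fin ltr01.
by rewrite oppr0 adde0 mule1.
Qed.

End corner.

(** * Cutting corners, and reversing the logarithm *)

Section chord_quotient.
Context {R : realType} {V : normedModType R}.

Lemma cvg_derive1_0 (y : R -> V) : derivable y 0 1 -> y 0 = 0 ->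
  d^-1 *: y d @[d --> 0^'] --> derive1 y 0.
Proof.
move=> dy y0; rewrite derive1E.
have -> : (fun d => d^-1 *: y d) =
    (fun h => h^-1 *: ((y \o shift 0) (h *: (1 : R)) - y 0)).
  by apply/funext => h; rewrite /= y0 subr0 addr0 [h *: 1]mulr1.
exact: dy.
Qed.

(** The chord that cuts the corner between the curve x1 before t and the curve x2
    after t has, at scale d, the sum of the two velocities as limit direction. *)
Lemma cvg_chord_quotient (x1 x2 : R -> V) (t : R) :
  derivable x1 t 1 -> derivable x2 t 1 -> x1 t = x2 t ->
  d^-1 *: (x2 (1 * d + t) - x1 (-1 * d + t)) @[d --> 0^'] -->
  derive1 x1 t + derive1 x2 t.
Proof.
move=> d1 d2 x12.
have t1 : -1 * 0 + t = t by rewrite mulr0 add0r.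
have t2 : 1 * 0 + t = t by rewrite mulr0 add0r.
rewrite -{1}t1 in d1; rewrite -{1}t2 in d2.
have [h1 e1] := derive1_affine d1; have [h2 e2] := derive1_affine d2.
pose y := (fun s => x2 (1 * s + t)) - (fun s => x1 (-1 * s + t)).
have dy : derivable y 0 1 by exact: derivableB h2 h1.
have -> : derive1 x1 t + derive1 x2 t = derive1 y 0.
  rewrite [RHS]derive1E [RHS](deriveB h2 h1) -!derive1E e1 e2 t1 t2.
  by rewrite scale1r scaleN1r opprK addrC.
have y0 : y 0 = 0.
  have -> : y 0 = x2 (1 * 0 + t) - x1 (-1 * 0 + t) by [].
  by rewrite t1 t2 x12 subrr.
exact: (cvg_derive1_0 dy y0).
Qed.

End chord_quotient.

Section reverse_logarithm.
Context {R : realType} {n : nat} (M : riemannian_manifold R n).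
Implicit Types (p q : M) (i j k : chart_index M) (c : R -> M) (v w : tvec M).

(** Only the cuts with d > 0 are used, whereas the estimates hold for all small d
    other than 0. *)
Lemma near_pos (P : R -> Prop) : (\forall d \near 0^', P d) -> exists2 d, 0 < d & P d.
Proof.
move=> nP.
have nP' : \forall d \near (0:R)^'+, P d.
  move: nP; rewrite !near_withinE; apply: filterS => d Pd d0; apply: Pd.
  by rewrite gt_eqF.
have n0 : \forall d \near (0:R)^'+, 0 < d by exact: nbhs_right_gt.
by have [d [d0 Pd]] := filter_ex (filterI n0 nP'); exists d.
Qed.

Lemma inner_le_sqr p v (L : R) : tnorm p v <= L -> inner p v v <= L ^+ 2.
Proof.
move=> vL; rewrite -(tnorm_sqr p v) ler_sqr// nnegrE; first exact: tnorm_ge0.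
exact: le_trans (tnorm_ge0 p v) vL.
Qed.

(** The parallelogram law. *)
Lemma parallelogram_le p u v (L : R) :
  4 * L ^+ 2 <= inner p (u + v) (u + v) ->
  inner p u u <= L ^+ 2 -> inner p v v <= L ^+ 2 ->
  inner p (u - v) (u - v) <= 0.
Proof.
rewrite -[- v]scaleN1r !(innerDl, innerDr, innerZl, innerZr) (innerC p v u).
lra.
Qed.

Lemma near_affine (P : R -> Prop) (a b : R) :
  (\forall s \near b, P s) -> \forall d \near 0^', P (a * d + b).
Proof.
move=> nP; apply: nbhs_dnbhs.
have ca : a * d + b @[d --> (0:R)] --> a * 0 + b by exact: continuous_affine.
by rewrite mulr0 add0r in ca; exact: ca.
Qed.

(** If the velocities u1 and u2 were different, then |u1 + u2| < 2 L by the
    parallelogram law, and the chart chord from c1 (1 - d) to c2 (1 + d), of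
    length about d |u1 + u2|, would be shorter than the distance 2 d L imposed on
    all curves between these points. *)
Lemma no_corner (e L : R) c1 c2 : 0 < e -> 0 <= L ->
  geodesic_on [set t | - e < t < 1 + e] c1 ->
  geodesic_on [set t | - e < t < 1 + e] c2 ->
  c1 1 = c2 1 ->
  tnorm (c1 1) (velocity c1 1) <= L -> tnorm (c2 1) (velocity c2 1) <= L ->
  (forall d l, 0 < d < e -> curve_length (c1 (1 - d)) (c2 (1 + d)) l ->
    ((2 * d * L)%:E <= l)%E) ->
  velocity c1 1 = velocity c2 1.
Proof.
move=> e0 L0 g1 g2 c12 L1 L2 HL; set p := c1 1 in c12 L1 *.
have J1 : [set t | - e < t < 1 + e] 1 by clear -e0; rewrite /=; lra.
have oJ := @open_oo R (- e) (1 + e).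
pose i := chart_at p; have ip : chart_dom i p by exact: chart_at_dom.
have ip2 : chart_dom i (c2 1) by rewrite -c12.
have t1 := geodesic_velocity_tangent g1 J1; have t2 := geodesic_velocity_tangent g2 J1.
set u1 := velocity c1 1 in L1 t1 *; set u2 := velocity c2 1 in L2 t2 *.
rewrite -c12 in L2 t2.
have cc1 := geodesic_continuous g1 J1; have cc2 := geodesic_continuous g2 J1.
pose x1 := chart i \o c1; pose x2 := chart i \o c2.
have d1 : derivable x1 1 1 := geodesic_derivable g1 J1 ip.
have d2 : derivable x2 1 1 := geodesic_derivable g2 J1 ip2.
have W4 : 4 * L ^+ 2 <= inner p (u1 + u2) (u1 + u2).
  rewrite leNgt; apply/negP => WL.
  set I := inner p (u1 + u2) (u1 + u2) in WL.
  have I0 : 0 <= I := inner_ge0 p _.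
  have e4 : (2 * L) ^+ 2 = 4 * L ^+ 2 by ring.
  have sI : Num.sqrt I < 2 * L.
    rewrite -(@ger0_norm _ (2 * L)) ?mulr_ge0// -sqrtr_sqr ltr_sqrt.
      by rewrite e4.
    by rewrite e4 (le_lt_trans I0).
  (* K separates the norm of u1 + u2 from 2 L strictly, as the estimate of the
     length of the chord is only asymptotic. *)
  pose K := (Num.sqrt I + 2 * L) / 2.
  have K0 : 0 <= K by rewrite divr_ge0// addr_ge0 ?sqrtr_ge0// mulr_ge0.
  have IK : I < K ^+ 2.
    rewrite -(sqr_sqrtr I0) ltr_sqr ?nnegrE ?sqrtr_ge0// /K; clear -sI; lra.
  have KL : K < 2 * L by rewrite /K; clear -sI; lra.
  have tW : tangent p (u1 + u2) by exact: tangentD.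
  rewrite /I (inner_chart ip tW tW) in IK.
  have [r r0 Hr] := chord_length ip K0 IK.
  have lim_y : d^-1 *: (x2 (1 * d + 1) - x1 (-1 * d + 1)) @[d --> 0^'] --> (u1 + u2) i.
    have x12 : x1 1 = x2 1 by rewrite /x1 /x2 /= -c12.
    have -> : (u1 + u2) i = derive1 x1 1 + derive1 x2 1.
      by rewrite tvec_addE /u1 /u2 (velocity_dom ip) (velocity_dom ip2).
    exact: cvg_chord_quotient d1 d2 x12.
  have nW : \forall d \near 0^', `|(u1 + u2) i -
      d^-1 *: (x2 (1 * d + 1) - x1 (-1 * d + 1))| < r.
    by move/cvgrPdist_lt : lim_y; apply.
  have n1 : \forall d \near 0^', `|x1 1 - x1 (-1 * d + 1)| < r /\
      chart_dom i (c1 (-1 * d + 1)).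
    apply: (near_affine (P := fun s => `|x1 1 - x1 s| < r /\ chart_dom i (c1 s))).
    apply: filterI; last exact: near_curve_dom.
    by have /cvgrPdist_lt := derivable1_continuous d1; apply.
  have n2 : \forall d \near 0^', `|x1 1 - x2 (1 * d + 1)| < r /\
      chart_dom i (c2 (1 * d + 1)).
    apply: (near_affine (P := fun s => `|x1 1 - x2 s| < r /\ chart_dom i (c2 s))).
    apply: filterI; last exact: near_curve_dom.
    have -> : x1 1 = x2 1 by rewrite /x1/x2/= -c12.
    by have /cvgrPdist_lt := derivable1_continuous d2; apply.
  have ne : \forall d \near (0:R)^', - e < d < e.
    have e00 : [set d | - e < d < e] 0 by rewrite /= oppr_lt0 e0.
    exact: nbhs_dnbhs (open_nbhs1 (@open_oo R (- e) e) e00).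
  have [d d0 [Wd [[x1d i1d] [[x2d i2d] de]]]] := near_pos
     (filterI nW (filterI n1 (filterI n2 ne))).
  have [l cl ll] := Hr (x1 (-1 * d + 1)) (x2 (1 * d + 1)) d x1d x2d d0 Wd.
  have dE1 : -1 * d + 1 = 1 - d by ring.
  have dE2 : 1 * d + 1 = 1 + d by ring.
  move: cl; rewrite /x1 /x2 /= !chartKq// dE1 dE2 => cl.
  have de' : 0 < d < e by rewrite d0; case/andP: de.
  have := le_trans (HL d l de' cl) ll.
  rewrite lee_fin leNgt => /negP; apply.
  by rewrite [2 * d]mulrC -mulrA ltr_pM2l.
apply/eqP; rewrite -subr_eq0; apply/eqP.
have tm : tangent p (u1 - u2) by apply: tangentD => //; rewrite -scaleN1r; exact: tangentZ.
apply: (inner_eq0 tm); apply/eqP; rewrite eq_le inner_ge0 andbT.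
have N1 := inner_le_sqr L1; have N2 := inner_le_sqr L2.
exact: parallelogram_le W4 N1 N2.
Unshelve. all: by end_near. Qed.

(** The geodesic t |-> exp_p ((1 - t) log_p q) runs from q to p and is as short as
    the radial geodesic t |-> exp_q (t log_q p), which stays minimizing a little
    beyond p because normal domains are open.  There is no corner where the first
    is continued by the second, so the two geodesics coincide. *)
Lemma logmap_reverse p q : Umax q p -> Umax p q ->
  logmap q p = - velocity (fun t : R => expmap p (t *: logmap p q)) 1.
Proof.
move=> Uqp Upq.
have [Vx xq] := logmapP Upq; have [Vy yp] := logmapP Uqp.
have nVp := Vmax_normal Upq; have nVq := Vmax_normal Uqp.
set x := logmap p q in Vx xq *; set y := logmap q p in Vy yp *.
pose g t := expmap p (t *: x); pose c2 t := expmap q (t *: y).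
have [[e1 e10 gg] g0 vg] := normal_domain_geodesic nVp Vx.
have [[e2 e20 gc2] c20 vc2] := normal_domain_geodesic nVq Vy.
rewrite -/g in gg; rewrite -/c2 in gc2.
have g1 : g 1 = q by rewrite /g scale1r.
have c21 : c2 1 = p by rewrite /c2 scale1r.
pose c1 s := g (-1 * s + 1).
(* Both geodesics are needed on a common interval around [0, 1]. *)
pose e := Num.min e1 e2; have e0 : 0 < e by rewrite lt_min e10.
have [ee1 ee2] : e <= e1 /\ e <= e2 by rewrite !ge_min !lexx orbT.
clearbody e.
have gc1 : geodesic_on [set t | - e < t < 1 + e] c1.
  apply: geodesic_sub (geodesic_affine (a := -1) (b := 1) (@open_oo R _ _) gg).
  by clear -ee1; move=> t /=; lra.
have {}gc2 : geodesic_on [set t | - e < t < 1 + e] c2.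
  by apply: geodesic_sub gc2; clear -ee2; move=> t /=; lra.
have c10 : c1 0 = q by rewrite /c1 mulr0 add0r.
have c11 : c1 1 = p by rewrite /c1 mulr1 addNr /g.
have vc1 : velocity c1 0 = - velocity g 1.
  rewrite (velocity_affine gg); last by rewrite /= mulr0 add0r; clear -e10; lra.
  by rewrite mulr0 add0r scaleN1r.
have J0 : - e < 0 < 1 + e by clear -e0; lra.
have J1 : - e < 1 < 1 + e by clear -e0; lra.
pose L := tnorm q y.
have Lp : gdist p q = (tnorm p x)%:E by exact: gdist_logmap.
have sc2 t : - e < t < 1 + e -> tnorm (c2 t) (velocity c2 t) = L.
  by move=> te; rewrite /tnorm (geodesic_speed (t := 0) gc2)// /c2 c20 vc2.
have L0 : 0 <= L by exact: tnorm_ge0.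
have xL : tnorm p x <= L.
  rewrite -lee_fin -Lp.
  have := geodesic_curve_length gc2 J1 J0; rewrite (sc2 1 J1) c21 [c2 0]c20 => /gdist_le.
  by rewrite sub0r normrN1 mul1r.
have sc1 t : - e < t < 1 + e -> tnorm (c1 t) (velocity c1 t) = tnorm p x.
  move=> te; rewrite /tnorm (geodesic_speed (t := 1) gc1)// c11.
  have -> : velocity c1 1 = - x.
    rewrite (velocity_affine gg); last by rewrite /= mulr1 addNr; clear -e10; lra.
    by rewrite mulr1 addNr scaleN1r vg.
  by rewrite -scaleN1r innerZl innerZr; congr Num.sqrt; ring.
(* The minimizing geodesic c2 can be continued beyond p. *)
have near_d : \forall d \near (0:R), Vmax q ((1 + d) *: y).
  pose i := chart_at q; have iq : chart_dom i q by exact: chart_at_dom.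
  have [[Vt Vo] _ _ _ _] := nVq; have yt := Vt _ Vy.
  have := Vo i iq => oVi.
  have yi : [set z | Vmax q (tvec_of q i z)] (y i) by rewrite /= tvec_ofK.
  have C : (1 + d) *: y i @[d --> (0:R)] --> y i.
    have C1 : (1 + d : R) @[d --> (0:R)] --> (1 + 0 : R).
      by apply: cvgD; [exact: cvg_cst|exact: cvg_id].
    suff : (1 + d) *: y i @[d --> (0:R)] --> (1 + 0 : R) *: y i.
      by rewrite addr0 scale1r.
    by apply: cvgZ C1 _; exact: (cvg_cst (y i)).
  have nV : \forall d \near (0:R), Vmax q (tvec_of q i ((1 + d) *: y i)).
    exact: C _ (open_nbhs1 oVi yi).
  by apply: filterS nV => d; rewrite (tvec_ofZ _ _ iq) (tvec_ofK iq yt).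
have [e' /= e'0 He'] := (nbhs_ballP (0:R) _).1 near_d.
(* The bound 1 keeps 1 - d nonnegative, so that it is the length ratio of the
   first piece. *)
pose e'' := Num.min (Num.min e e') 1.
have e''0 : 0 < e'' by rewrite !lt_min e0 ltr01 andbT.
have [le1 [le2 le3]] : e'' <= e /\ e'' <= e' /\ e'' <= 1.
  by rewrite !ge_min !lexx !orbT.
have v12 : velocity c1 1 = velocity c2 1.
  apply: (no_corner (e := e'') (L := L)) => //.
  - by apply: geodesic_sub gc1; clear -le1; move=> t /=; lra.
  - by apply: geodesic_sub gc2; clear -le1; move=> t /=; lra.
  - by rewrite c11.
  - by rewrite sc1.
  - by rewrite sc2.
  move=> d l /andP[d0 de] cl.
  have Vd : Vmax q ((1 + d) *: y).
    by apply: He'; rewrite -ball_normE/= sub0r normrN gtr0_norm//; exact: lt_le_trans le2.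
  have := normal_domain_gdist nVq Vd; rewrite -/(c2 (1 + d)) tnormZ -/L.
  rewrite ger0_norm; last by clear -d0; lra.
  move=> Gd; have Jd : - e < 1 - d < 1 + e by clear -d0 de le1 le3 e0; lra.
  have := geodesic_curve_length gc1 J0 Jd; rewrite (sc1 0 J0) c10 subr0.
  rewrite ger0_norm; last by clear -de le3; lra.
  move=> A1; have := gdist_le (curve_cat A1 cl); rewrite Gd.
  have dL : (1 - d) * tnorm p x <= (1 - d) * L by rewrite ler_wpM2l//; clear -de le3; lra.
  case: l {cl} => [l| |] /=; [|by move=> _; rewrite leey|by rewrite addeNy leeNy_eq].
  by rewrite -EFinD !lee_fin; clear -dL l; lra.
have c12 : c1 1 = c2 1 by rewrite c11.
have E : {near (0:R), c1 =1 c2}.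
  apply: filterS (open_nbhs1 (@open_oo R (-e) (1 + e)) J0) => t te.
  exact: (geodesic_unique gc1 gc2 J1 c12 v12 te).
by rewrite -[RHS]vc1 (near_eq_velocity E) vc2.
Qed.

End reverse_logarithm.

(** * Continuity of the logarithm in both arguments *)

Section log_continuity.
Context {R : realType} {n : nat} (M : riemannian_manifold R n).
Implicit Types (p q : M) (i j : chart_index M) (v w : tvec M).

Lemma Umax_open q : open (Umax q : set M).
Proof.
apply: nbhs_open => p Up.
by have [_ _ _ [_ _ oU _ _] _] := Vmax_normal Up; exact: open_nbhs1.
Qed.

Lemma logmap_continuous q p i : Umax q p -> chart_dom i q ->
  {for p, continuous (fun r : M => logmap q r i)}.
Proof.
move=> Up iq; have [_ _ _ [_ _ _ _ /(_ i iq) sl] _] := Vmax_normal Up.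
pose j := chart_at p; have jp : chart_dom j p by exact: chart_at_dom.
have Aj : (chart j @` (chart_dom j `&` expmap q @` Vmax q)) (chart j p).
  by exists p.
have h1 := smooth_on_continuous (sl j) Aj.
have h2 := chart_continuous jp.
have h3 : logmap_on (Vmax q) q (chart_inv j (chart j r)) i @[r --> p] -->
    logmap_on (Vmax q) q (chart_inv j (chart j p)) i.
  exact: (cvg_comp _ _ h2 h1).
rewrite (chartKq jp) in h3; apply: cvg_trans h3; apply: near_eq_cvg.
by apply: filterS (near_chart_dom jp) => r jr; rewrite (chartKq jr).
Qed.

Lemma inner_cvg T (F : set_system T) {FF : Filter F} (q : T -> M)
    (v w : T -> tvec M) q0 v0 w0 i :
  chart_dom i q0 -> q t @[t --> F] --> q0 ->
  (forall t, tangent (q t) (v t)) -> (forall t, tangent (q t) (w t)) ->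
  tangent q0 v0 -> tangent q0 w0 ->
  v t i @[t --> F] --> v0 i -> w t i @[t --> F] --> w0 i ->
  inner (q t) (v t) (w t) @[t --> F] --> inner q0 v0 w0.
Proof.
move=> iq0 qq0 vt wt v0t w0t vv0 ww0.
rewrite (inner_chart iq0 v0t w0t).
have H : ((v t i)^T *m metric i (q t) *m w t i) 0 0 @[t --> F] -->
    ((v0 i)^T *m metric i q0 *m w0 i) 0 0.
  apply: cvg_coord; apply: cvg_mulmx => //; apply: cvg_mulmx.
    exact: cvg_trmx.
  exact: (cvg_comp _ _ qq0 (metric_continuous iq0)).
apply: cvg_trans H; apply: near_eq_cvg.
have nq : \forall t \near F, chart_dom i (q t) by exact: qq0 _ (near_chart_dom iq0).
by apply: filterS nq => t iqt; rewrite (inner_chart iqt (vt t) (wt t)).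
Qed.

(** By [logmap_reverse], log_q p is read off from the differential of exp_p at
    log_p q, applied to log_p q; both depend continuously on q. *)
Lemma logmap_cvg (q : nat -> M) q0 p i :
  q k @[k --> \oo] --> q0 ->
  (forall k, Umax (q k) p) -> (forall k, Umax p (q k)) ->
  Umax q0 p -> Umax p q0 -> chart_dom i q0 ->
  logmap (q k) p i @[k --> \oo] --> logmap q0 p i.
Proof.
move=> qq0 Uqp Upq Uq0p Upq0 iq0.
pose j := chart_at p; have jp : chart_dom j p by exact: chart_at_dom.
have nV := Vmax_normal Upq0.
pose E x := expmap p (tvec_of p j x).
pose A := [set x | Vmax p (tvec_of p j x) /\ chart_dom i (E x)].
pose f := chart i \o E.
have [[_ /(_ j jp) oV] _ _ [_ _ _ /(_ j jp) [cE sE] _] _] := nV.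
have oA : open A.
  apply: nbhs_open => x [Vx iEx]; apply: filterI; first exact: open_nbhs1.
  exact: cE Vx _ (near_chart_dom iEx).
have sf : smooth_on A f by exact: sE.
pose xi r := logmap p r j.
have xiE r : Umax p r -> tvec_of p j (xi r) = logmap p r.
  by move=> Upq'; rewrite /xi (tvec_ofK jp)//; exact: logmap_tangent.
have Exi r : Umax p r -> E (xi r) = r.
  by move=> Upq'; rewrite /E xiE//; have [] := logmapP Upq'.
have Axi r : Umax p r -> chart_dom i r -> A (xi r).
  move=> Upq' iq; split; last by rewrite Exi.
  by rewrite xiE//; have [] := logmapP Upq'.
have logE r : Umax p r -> Umax r p -> chart_dom i r ->
    logmap r p i = - 'd f (xi r) (xi r).
  move=> Upq' Uqp' iq; rewrite (logmap_reverse Uqp' Upq').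
  rewrite -[LHS]/(- velocity (fun t : R => expmap p (t *: logmap p r)) 1 i).
  congr (- _).
  have [Vl El] := logmapP Upq'.
  rewrite velocity_dom; last by rewrite scale1r El.
  pose l (t : R) := t *: xi r.
  have dl : is_derive (1 : R) 1 l (xi r).
    exact: is_derive_scalel.
  have l1 : l 1 = xi r by rewrite /l scale1r.
  have fl : chart i \o (fun t : R => expmap p (t *: logmap p r)) = f \o l.
    apply/funext => t; rewrite /f /E /l /= (tvec_ofZ _ _ jp) xiE//.
  have df : differentiable f (l 1).
    by rewrite l1; exact: smooth_on_differentiable sf (Axi _ Upq' iq).
  have [dl1 dl2] := dl.
  rewrite fl (derive1_comp_diff dl1 df) l1; congr ('d f _ _).
  by rewrite derive1E.
have xicvg : xi (q k) @[k --> \oo] --> xi q0.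
  exact: (cvg_comp _ _ qq0 (logmap_continuous Upq0 jp)).
have nq : \forall k \near \oo, chart_dom i (q k) by exact: qq0 _ (near_chart_dom iq0).
rewrite logE//.
have C : - 'd f (xi (q k)) (xi (q k)) @[k --> \oo] --> - 'd f (xi q0) (xi q0).
  apply: cvgN; exact: (smooth_cvg_diff oA sf (Axi _ Upq0 iq0) xicvg xicvg).
apply: cvg_trans C; apply: near_eq_cvg; apply: filterS nq => k iqk.
by rewrite (logE _ (Upq k) (Uqp k) iqk).
Qed.

End log_continuity.

(** * The covariance tensor as an integral *)

Section measurability.
Context {R : realType} {n : nat} (M : riemannian_manifold R n).
Implicit Types (p q : M) (i j : chart_index M) (v w : tvec M).

Lemma open_borel (A : set M) : open A -> measurable (A : set (borel M)).
Proof. by move=> oA; exact: sub_sigma_algebra. Qed.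

(** On an open set, preimages of open intervals under a continuous function are
    open. *)
Lemma continuous_borel_measurable (D : set M) (f : M -> R) : open D ->
  (forall p, D p -> {for p, continuous f}) ->
  measurable_fun (D : set (borel M)) f.
Proof.
move=> oD cf; apply: (measurability _ (RGenOpens.measurableE R)).
move=> _ [_ [a [b ->] <-]]; apply: open_borel.
apply: nbhs_open => p [Dp fp]; apply: filterI; first exact: open_nbhs1.
exact: (cf p Dp) _ (open_nbhs1 (@interval_open _ (BRight a) (BLeft b) isT isT) fp).
Qed.

Lemma inner_logmap_continuous q v p : Umax q p ->
  {for p, continuous (fun r => inner q v (logmap q r))}.
Proof.
move=> Up; pose i := chart_at q.
have iq : chart_dom i q by exact: chart_at_dom.
rewrite /prop_for /continuous_at /inner -/i.
apply: cvg_coord; apply: cvg_mulmx; first exact: cvg_cst.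
exact: (logmap_continuous Up iq).
Qed.

Lemma tnorm_sqr_logmap_continuous q p : Umax q p ->
  {for p, continuous (fun r => tnorm q (logmap q r) ^+ 2)}.
Proof.
move=> Up; pose i := chart_at q.
have iq : chart_dom i q by exact: chart_at_dom.
have lc := logmap_continuous Up iq.
have -> : (fun r => tnorm q (logmap q r) ^+ 2) =
   (fun r => inner q (logmap q r) (logmap q r)).
  by apply/funext => r; rewrite tnorm_sqr.
rewrite /prop_for /continuous_at /inner -/i.
apply: cvg_coord; apply: cvg_mulmx; last exact: lc.
apply: cvg_mulmx; last exact: cvg_cst.
exact: cvg_trmx.
Qed.

(** The integrand of <v, G Sigma(q) w>.  Unlike the entries of the matrix [Sigma],
    it does not depend on a chart, so that integrals at different points q can be
    compared. *)
Definition cov_integrand q v w (p : M) : R :=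
  inner q v (logmap q p) * inner q w (logmap q p).

Lemma cov_integrand_continuous q v w p : Umax q p ->
  {for p, continuous (cov_integrand q v w)}.
Proof. by move=> Up; apply: cvgM; exact: inner_logmap_continuous. Qed.

Lemma cov_integrand_le q v w p :
  `|cov_integrand q v w p| <= tnorm q v * tnorm q w * tnorm q (logmap q p) ^+ 2.
Proof.
rewrite normrM expr2 mulrACA; apply: ler_pM => //; exact: inner_le.
Qed.

Section integrals.
Variable F : probability (borel M) R.

Lemma measurable_Umax q : measurable (Umax q : set (borel M)).
Proof. by apply: open_borel; exact: Umax_open. Qed.

Lemma measurable_cov_integrand q v w :
  measurable_fun (Umax q : set (borel M)) (cov_integrand q v w).
Proof.
apply: continuous_borel_measurable; first exact: Umax_open.
by move=> p; exact: cov_integrand_continuous.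
Qed.

Lemma measurable_tnorm_sqr q :
  measurable_fun (Umax q : set (borel M)) (fun p => tnorm q (logmap q p) ^+ 2).
Proof.
apply: continuous_borel_measurable; first exact: Umax_open.
by move=> p; exact: tnorm_sqr_logmap_continuous.
Qed.

Lemma integrable_tnorm_sqr q : (tr_GSigma F q < +oo)%E ->
  F.-integrable (Umax q : set (borel M))
    (EFin \o (fun p => tnorm q (logmap q p) ^+ 2)).
Proof.
move=> trq; apply/integrableP; split.
  by apply/measurable_EFinP; exact: measurable_tnorm_sqr.
apply: le_lt_trans trq; rewrite le_eqVlt; apply/orP; left; apply/eqP.
apply: eq_integral => p _; rewrite /= ger0_norm// sqr_ge0//.
Qed.

Lemma integrable_cov q v w : (tr_GSigma F q < +oo)%E ->
  F.-integrable (Umax q : set (borel M)) (EFin \o cov_integrand q v w).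
Proof.
move=> trq.
have ig : F.-integrable (Umax q : set (borel M))
    (fun p => (tnorm q v * tnorm q w)%:E * (tnorm q (logmap q p) ^+ 2)%:E)%E.
  by apply: integrableZl; [exact: measurable_Umax|exact: integrable_tnorm_sqr].
apply: le_integrable ig; first exact: measurable_Umax.
  by apply/measurable_EFinP; exact: measurable_cov_integrand.
move=> p _; rewrite /= lee_fin [leRHS]ger0_norm.
  exact: cov_integrand_le.
by rewrite !mulr_ge0 ?tnorm_ge0// sqr_ge0.
Qed.

Lemma Rintegral_sum (I : finType) (D : set (borel M)) (f : I -> borel M -> R) :
  measurable D -> (forall k, F.-integrable D (EFin \o f k)) ->
  \int[F]_(p in D) (\sum_k f k p) = \sum_k \int[F]_(p in D) f k p.
Proof.
move=> mD fi; rewrite /Rintegral.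
transitivity (fine (\sum_k \int[F]_(p in D) (f k p)%:E)%E).
  congr fine; rewrite -integral_sum//.
  by apply: eq_integral => p _; rewrite sumEFin.
by rewrite -sum_fine// => k _; exact: (integrable_fin_num mD (fi k)).
Qed.

(** The vector that represents the coordinate a for the metric, in the chart
    chosen at q: entries of [Sigma] become instances of [cov_integrand], which
    gives their integrability. *)
Definition dual_coord q (a : 'I_n) : tvec M :=
  fun=> invmx (metric (chart_at q) q) *m delta_mx a 0.

Lemma dual_coordE q v a : inner q (dual_coord q a) v = v (chart_at q) a 0.
Proof.
have aq := chart_at_dom q.
rewrite /inner trmx_mul trmx_inv (Defs.metric_sym aq).
rewrite mulmxKV; last exact: metric_unit.
rewrite mxE (bigD1 a)//= big1.
  by rewrite !mxE !eqxx mul1r addr0.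
by move=> b ba; rewrite !mxE (negbTE ba) mul0r.
Qed.

(** Expanding v and w in coordinates, both sides are the same finite combination
    of the entries of [Sigma]; the finiteness of the trace makes every entry
    integrable, so that the integral may be expanded. *)
Lemma inner_GSigma q v w : (tr_GSigma F q < +oo)%E ->
  inner q v (GSigma F q w) = \int[F]_(p in Umax q) cov_integrand q v w p.
Proof.
move=> trq; pose i := chart_at q.
have iq : chart_dom i q by exact: chart_at_dom.
pose al (a : 'I_n) := inner q v (fun=> delta_mx a 0).
pose be (a : 'I_n) := inner q w (fun=> delta_mx a 0).
have innerE u (x : tvec M) : inner q u x =
    \sum_a inner q u (fun=> delta_mx a 0) * x i a 0.
  rewrite /inner mxE; apply: eq_bigr => a _; congr (_ * _).
  rewrite [RHS]mxE (bigD1 a)//= big1 ?addr0; first by rewrite [X in _ * X]mxE !eqxx mulr1.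
  by move=> b ba; rewrite [X in _ * X]mxE (negbTE ba) mulr0.
have covE p : cov_integrand q v w p = \sum_ab al ab.1 * be ab.2 *
    cov_integrand q (dual_coord q ab.1) (dual_coord q ab.2) p.
  rewrite /cov_integrand (innerE v) (innerE w) big_distrlr/= pair_bigA/=.
  by apply: eq_bigr => -[a b] _ /=; rewrite !dual_coordE mulrACA.
under eq_Rintegral do rewrite covE.
rewrite Rintegral_sum; [|exact: measurable_Umax|]; last first.
  move=> [a b] /=.
  have ig : F.-integrable (Umax q : set (borel M)) (fun p => (al a * be b)%:E *
      (cov_integrand q (dual_coord q a) (dual_coord q b) p)%:E)%E.
    by apply: integrableZl; [exact: measurable_Umax|exact: integrable_cov].
  exact: ig.
rewrite innerE.
have beE b : (metric i q *m w i) b 0 = be b.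
  rewrite /be innerC /inner -/i -mulmxA [RHS]mxE (bigD1 b)//= big1 ?addr0.
    by rewrite [X in X * _]mxE [X in X * _]mxE !eqxx mul1r.
  by move=> c cb; rewrite [X in X * _]mxE [X in X * _]mxE (negbTE cb) mul0r.
transitivity (\sum_a \sum_b al a * be b * Sigma F i q a b).
  apply: eq_bigr => a _; rewrite -/(al a) /GSigma asboolT// -mulmxA mxE mulr_sumr.
  by apply: eq_bigr => b _; rewrite beE mulrAC -mulrA.
rewrite pair_bigA/=; apply: eq_bigr => -[a b] _ /=.
rewrite RintegralZl; [|exact: measurable_Umax|exact: integrable_cov].
congr (_ * _); rewrite /Sigma mxE; apply: eq_Rintegral => p _.
by rewrite /cov_integrand !dual_coordE mxE big_ord1 mxE.
Qed.

End integrals.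
End measurability.

(** * Passage to the limit *)

Section limit.
Context {R : realType} {n : nat} (M : riemannian_manifold R n).
Implicit Types (p q : M) (v w : tvec M).

(** The triangle inequality: a curve from q to q0 of length less than 1, followed
    by the minimizing geodesic from q0 to p, is at least as long as d(q, p). *)
Lemma tnorm_logmap_le q q0 p : Umax q p -> Umax q0 p -> (gdist q q0 < 1)%E ->
  tnorm q (logmap q p) <= 1 + tnorm q0 (logmap q0 p).
Proof.
move=> Uqp Uq0p /ereal_inf_lt[l ql l1].
have [Vl lp] := logmapP Uq0p; have nV := Vmax_normal Uq0p.
have [[e e0 ge] E0 v0] := normal_domain_geodesic nV Vl.
have := curve_arc (geodesic_C1_arc e0 ge).
rewrite (arc_length_geodesic e0 ge) v0 E0 scale1r lp => cl.
have := gdist_le (curve_cat ql cl); rewrite (gdist_logmap Uqp) => H.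
rewrite -lee_fin EFinD; apply: (le_trans H); rewrite leeD2r//; exact: ltW.
Qed.

Section restriction.
Variable F : probability (borel M) R.

(** Sets of full measure can replace U(q): this allows one common domain for all
    the points of the sequence. *)
Lemma Rintegral_Umax q (D : set (borel M)) (f : M -> R) :
  measurable D -> F (~` D) = 0%E -> D `<=` Umax q ->
  F.-integrable (Umax q : set (borel M)) (EFin \o f) ->
  \int[F]_(p in Umax q) f p = \int[F]_(p in D) f p.
Proof.
move=> mD D0 DU fi; congr fine.
rewrite (negligible_integral (N := ~` D) _ _ fi D0); last 2 first.
- exact: measurableC.
- exact: measurable_Umax.
by rewrite setDE setCK setIidr.
Qed.

End restriction.

Lemma null_setC (F : probability (borel M) R) q :
  F (Umax q) = 1%E -> F (~` (Umax q : set (borel M))) = 0%E.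
Proof.
move=> F1; rewrite probability_setC ?F1 ?subee//; exact: measurable_Umax.
Qed.

(** (1 + t)^2 <= 2 + 2 t^2, and t^2 integrates to the trace. *)
Lemma integrable_dominant (F : probability (borel M) R) q0 (D : set (borel M)) (C : R) :
  measurable D -> D `<=` Umax q0 -> (tr_GSigma F q0 < +oo)%E ->
  F.-integrable D (EFin \o (fun p => C * (1 + tnorm q0 (logmap q0 p)) ^+ 2)).
Proof.
move=> mD DU tr0; pose U : set (borel M) := Umax q0.
have mU : measurable U by exact: measurable_Umax.
pose t0 p := tnorm q0 (logmap q0 p).
apply: (integrableS mU mD DU).
have i1 : F.-integrable U (fun p => 2%:E + 2%:E * (t0 p ^+ 2)%:E)%E.
  apply: (integrableD mU).
    exact: (finite_measure_integrable_cst F 2 mU).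
  apply: (integrableZl mU); exact: integrable_tnorm_sqr.
have i2 : F.-integrable U (fun p => C%:E * (2%:E + 2%:E * (t0 p ^+ 2)%:E))%E.
  exact: (integrableZl mU).
apply: (le_integrable mU _ _ i2).
  apply/measurable_EFinP; apply: continuous_borel_measurable.
    exact: Umax_open.
  move=> p Up; have t0c : {for p, continuous t0}.
    have -> : t0 = (fun r => Num.sqrt (t0 r ^+ 2)).
      by apply/funext => r; rewrite sqrtr_sqr ger0_norm// tnorm_ge0.
    apply: (continuous_comp (tnorm_sqr_logmap_continuous Up)).
    exact: sqrt_continuous.
  have c1 : {for p, continuous (fun r => 1 + t0 r)}.
    by apply: cvgD => //; exact: cvg_cst.
  apply: cvgM; first exact: cvg_cst.
  by under eq_fun do rewrite expr2; rewrite expr2; exact: cvgM.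
move=> p _; rewrite /= lee_fin [leLHS]normrM [leRHS]normrM ler_wpM2l//.
rewrite -/(t0 p).
have h1 : 0 <= (1 + t0 p) ^+ 2 by exact: sqr_ge0.
have h2 : 0 <= 2 + 2 * t0 p ^+ 2 by rewrite addr_ge0// mulr_ge0// sqr_ge0.
rewrite (ger0_norm h1) (ger0_norm h2) -subr_ge0.
rewrite (_ : _ - _ = (1 - t0 p) ^+ 2); first exact: sqr_ge0.
by ring.
Qed.

Lemma tr_GSigma_fin (F : probability (borel M) R) q q0 :
  F (Umax q) = 1%E -> F (Umax q0) = 1%E -> (gdist q q0 < 1)%E ->
  (tr_GSigma F q0 < +oo)%E -> (tr_GSigma F q < +oo)%E.
Proof.
move=> Fq Fq0 qq0 tr0; pose D : set (borel M) := Umax q `&` Umax q0.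
have mD : measurable D by apply: measurableI; exact: measurable_Umax.
have D0 : F (~` D) = 0%E.
  rewrite setCI null_set_setU//; do ?[exact: null_setC].
    by apply: measurableC; exact: measurable_Umax.
  by apply: measurableC; exact: measurable_Umax.
rewrite /tr_GSigma (ge0_negligible_integral (N := ~` D)) //; first last.
- by move=> p _; rewrite lee_fin sqr_ge0.
- by apply/measurable_EFinP; exact: measurable_tnorm_sqr.
- exact: measurable_Umax.
- exact: measurableC.
rewrite setDE setCK setIidr; last by move=> p [].
have DU : D `<=` Umax q0 by move=> p [].
have iD := integrable_dominant 1 mD DU tr0.
apply: (@le_lt_trans _ _ (\int[F]_(p in D)
   (1 * (1 + tnorm q0 (logmap q0 p)) ^+ 2)%:E)%E); last first.
  exact: (integrable_lty mD iD).
apply: ge0_le_integral => //.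
- by move=> p _; rewrite lee_fin sqr_ge0.
- apply: (measurable_funS (measurable_Umax q)); first by move=> p [].
  by apply/measurable_EFinP; exact: measurable_tnorm_sqr.
- exact: measurable_int iD.
- move=> p [Up U0p]; rewrite lee_fin mul1r ler_sqr ?nnegrE ?tnorm_ge0//.
    exact: tnorm_logmap_le.
  by rewrite addr_ge0 ?tnorm_ge0.
Qed.

(** Dominated convergence on the intersection of all the U(q_k), which has full
    measure.  The distances and norms of a convergent sequence satisfy these bounds
    from some index on, and the sequence can be shifted. *)
Lemma cov_cvg (F : probability (borel M) R) (q : nat -> M) (v w : nat -> tvec M)
    q0 v0 w0 (i := chart_at q0) :
  (forall p r : M, Umax p r <-> Umax r p) ->
  (forall k, (gdist (q k) q0 < 1)%E) -> q k @[k --> \oo] --> q0 ->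
  F (Umax q0) = 1%E -> (forall k, F (Umax (q k)) = 1%E) ->
  (tr_GSigma F q0 < +oo)%E ->
  (forall k, tangent (q k) (v k)) -> (forall k, tangent (q k) (w k)) ->
  tangent q0 v0 -> tangent q0 w0 ->
  (forall k, tnorm (q k) (v k) <= 1 + tnorm q0 v0) ->
  (forall k, tnorm (q k) (w k) <= 1 + tnorm q0 w0) ->
  v k i @[k --> \oo] --> v0 i -> w k i @[k --> \oo] --> w0 i ->
  inner (q k) (v k) (GSigma F (q k) (w k)) @[k --> \oo] -->
    inner q0 v0 (GSigma F q0 w0).
Proof.
move=> Us dq qq0 F0 Fk tr0 vt wt v0t w0t vb wb vv0 ww0.
have iq0 : chart_dom i q0 by exact: chart_at_dom.
have trk k : (tr_GSigma F (q k) < +oo)%E by exact: tr_GSigma_fin (dq k) tr0.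
pose D : set (borel M) := Umax q0 `&` \bigcap_k Umax (q k).
have mD : measurable D.
  apply: measurableI; first exact: measurable_Umax.
  by apply: bigcapT_measurable => k; exact: measurable_Umax.
have DU0 : D `<=` Umax q0 by move=> p [].
have DUk k : D `<=` Umax (q k) by move=> p [_ /(_ k)]; exact.
have D0 : F (~` D) = 0%E.
  apply: measure_negligible; first exact: measurableC.
  rewrite setCI setC_bigcap; apply: negligibleU.
    apply/negligibleP; last exact: null_setC.
    by apply: measurableC; exact: measurable_Umax.
  apply: negligible_bigcup => k; apply/negligibleP; last exact: null_setC.
  by apply: measurableC; exact: measurable_Umax.
have E0 : inner q0 v0 (GSigma F q0 w0) = \int[F]_(p in D) cov_integrand q0 v0 w0 p.
  rewrite (inner_GSigma _ _ tr0); apply: Rintegral_Umax => //.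
  exact: integrable_cov.
have Ek k : inner (q k) (v k) (GSigma F (q k) (w k)) =
    \int[F]_(p in D) cov_integrand (q k) (v k) (w k) p.
  rewrite (inner_GSigma _ _ (trk k)); apply: Rintegral_Umax => //.
  exact: integrable_cov.
rewrite E0; under eq_fun do rewrite Ek.
pose C := (1 + tnorm q0 v0) * (1 + tnorm q0 w0).
have [] := @dominated_convergence _ _ _ F D mD
  (fun k p => (cov_integrand (q k) (v k) (w k) p)%:E)
  (fun p => (cov_integrand q0 v0 w0 p)%:E)
  (fun p => (C * (1 + tnorm q0 (logmap q0 p)) ^+ 2)%:E).
- move=> k; apply: (measurable_funS (measurable_Umax (q k))); first exact: DUk.
  by apply/measurable_EFinP; exact: measurable_cov_integrand.
- apply: (measurable_funS (measurable_Umax q0)) => //.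
  by apply/measurable_EFinP; exact: measurable_cov_integrand.
- apply: aeW => p Dp; apply: cvg_EFin; first exact: nearW.
  have U0p : Umax q0 p by exact: DU0.
  have Ukp k : Umax (q k) p by exact: DUk.
  have Lcvg : logmap (q k) p i @[k --> \oo] --> logmap q0 p i.
    apply: logmap_cvg => //; first by move=> k; exact/Us.
    exact/Us.
  by apply: cvgM; apply: (inner_cvg iq0 qq0) => //;
    do ?[move=> k; exact: logmap_tangent|exact: logmap_tangent].
- exact: integrable_dominant.
- apply: aeW => p k Dp; rewrite lee_fin.
  have U0p : Umax q0 p by exact: DU0.
  have Ukp : Umax (q k) p by exact: DUk.
  apply: (le_trans (cov_integrand_le _ _ _ _)).
  apply: ler_pM; rewrite ?mulr_ge0 ?tnorm_ge0 ?sqr_ge0//.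
    by apply: ler_pM; rewrite ?tnorm_ge0.
  rewrite ler_sqr ?nnegrE ?tnorm_ge0 ?addr_ge0 ?tnorm_ge0//.
  exact: tnorm_logmap_le.
move=> i0 _ H; apply: fine_cvg; rewrite /Rintegral fineK//.
exact: (integrable_fin_num mD i0).
Qed.

End limit.

Unset Implicit Arguments.

Theorem proposition2 (R : realType) (n : nat) (M : riemannian_manifold R n)
  (Umax_sym : forall p q : M, Umax q p <-> Umax p q)
  (F : probability (borel M) R)
  (q : nat -> M)
  (q_cvg : gdist (q k) (q 0%N) @[k --> \oo] --> 0%E)
  (F_Umax : forall k, F (Umax (q k)) = 1%E)
  (tr_finite : (tr_GSigma F (q 0%N) < +oo)%E)
  (v w : nat -> tvec M)
  (v_tangent : forall k, tangent (q k) (v k))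
  (w_tangent : forall k, tangent (q k) (w k))
  (v_cvg : TM_cvg q v (q 0%N) (v 0%N))
  (w_cvg : TM_cvg q w (q 0%N) (w 0%N)) :
  inner (q k) (v k) (GSigma F (q k) (w k)) @[k --> \oo] -->
    inner (q 0%N) (v 0%N) (GSigma F (q 0%N) (w 0%N)).
Proof.
pose i := chart_at (q 0%N).
have iq0 : chart_dom i (q 0%N) by exact: chart_at_dom.
have qq0 := TM_cvg_base v_cvg.
have vv0 := TM_cvg_fiber v_cvg (v_tangent 0%N) v_tangent iq0.
have ww0 := TM_cvg_fiber w_cvg (w_tangent 0%N) w_tangent iq0.
have tnorm_bound (u : nat -> tvec M) : (forall k, tangent (q k) (u k)) ->
    u k i @[k --> \oo] --> u 0%N i ->
    \forall k \near \oo, tnorm (q k) (u k) <= 1 + tnorm (q 0%N) (u 0%N).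
  move=> ut uu0.
  have tc : tnorm (q k) (u k) @[k --> \oo] --> tnorm (q 0%N) (u 0%N).
    apply: (@cvg_comp _ _ _ (fun k => inner (q k) (u k) (u k)) Num.sqrt).
      exact: (inner_cvg iq0 qq0 ut ut (ut 0%N) (ut 0%N) uu0 uu0).
    exact: sqrt_continuous.
  have /cvgrPdist_le/(_ 1 ltr01) := tc; apply: filterS => k.
  by rewrite distrC => /ler_distlDr; rewrite addrC.
have near1 : \forall k \near \oo, (gdist (q k) (q 0%N) < 1)%E.
  have : nbhs (0 : \bar R)%E [set x | (x < 1)%E].
    by apply: open_nbhs1; [exact: open_ereal_lt_ereal|rewrite /= lte01].
  exact: q_cvg.
(* Only large indices matter: shift the sequence so that the distances are less
   than 1 and the norms are bounded from the start. *)
have [N _ HN] := filterI near1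
  (filterI (tnorm_bound v v_tangent vv0) (tnorm_bound w w_tangent ww0)).
rewrite -(cvg_shiftn N) /=.
rewrite -(cvg_shiftn N) /= in qq0.
rewrite -(cvg_shiftn N) /= in vv0.
rewrite -(cvg_shiftn N) /= in ww0.
have HNk k := HN (k + N)%N (leq_addl k N).
apply: (cov_cvg (q := fun k => q (k + N)%N) (v := fun k => v (k + N)%N)
  (w := fun k => w (k + N)%N)) => //; by move=> k; have [? []] := HNk k.
Qed.
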